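(* Let $n,r\in\mathbb N$ with $r<n$. The bipartite strategy with $5$ inputs for the first party, $4$ inputs for the second party, and $2$ outputs per input, $$\mathcal S_{n,r}=\Big(|\phi_n\rangle;\ (\mathfrak P^{(n)}_i,I-\mathfrak P^{(n)}_i)_{i=1}^4,\ (\mathfrak Q^{(n,r)},I-\mathfrak Q^{(n,r)});\ (\mathfrak P^{(n)}_i,I-\mathfrak P^{(n)}_i)_{i=1}^4\Big),$$ is self-tested by its correlation.
   Context: A bipartite strategy $\mathcal S=(|\psi\rangle;\mathcal M_1,\dots,\mathcal M_{N_A};\mathcal N_1,\dots,\mathcal N_{N_B})$ consists of finite-dimensional Hilbert spaces $\mathcal H_A,\mathcal H_B$, a unit vector $|\psi\rangle\in\mathcal H_A\otimes\mathcal H_B$, POVMs $\mathcal M_i=(\mathcal M_{i,a})_a$ on $\mathcal H_A$ and POVMs $\mathcal N_j=(\mathcal N_{j,b})_b$ on $\mathcal H_B$ (tuples of positive semidefinite operators summing to $I$). Its correlation is $p(a,b|i,j)=\langle\psi|\mathcal M_{i,a}\otimes\mathcal N_{j,b}|\psi\rangle$. A strategy $\widetilde{\mathcal S}=(|\widetilde\psi\rangle;\widetilde{\mathcal M};\widetilde{\mathcal N})$ on $\widetilde{\mathcal H}_A\otimes\widetilde{\mathcal H}_B$ (with the same numbers of inputs and outputs) is a local dilation of $\mathcal S$ if there exist finite-dimensional Hilbert spaces $\mathcal K_A,\mathcal K_B$, a state $|\mathrm{aux}\rangle\in\mathcal K_A\otimes\mathcal K_B$ and isometries $U_A:\mathcal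 H_A\to\widetilde{\mathcal H}_A\otimes\mathcal K_A$, $U_B:\mathcal H_B\to\widetilde{\mathcal H}_B\otimes\mathcal K_B$ with $(U_A\otimes U_B)(\mathcal M_{i,a}\otimes\mathcal N_{j,b})|\psi\rangle=(\widetilde{\mathcal M}_{i,a}\otimes\widetilde{\mathcal N}_{j,b})|\widetilde\psi\rangle\otimes|\mathrm{aux}\rangle$ for all $i,j,a,b$. $\widetilde{\mathcal S}$ is self-tested by its correlation if it is a local dilation of every strategy with the same numbers of inputs and outputs and the same correlation. $|\phi_n\rangle=\frac1{\sqrt n}\sum_{i=1}^n|i\rangle|i\rangle$. For an invertible Hermitian $X$, $\operatorname{sgn}(X)$ is the unique Hermitian unitary commuting with $X$ with $\operatorname{sgn}(X)X$ positive definite. For $n\in\mathbb N$, $\mathfrak P^{(n)}_1,\dots,\mathfrak P^{(n)}_4\in M_n(\mathbb R)$ denote orthogonal projections (real symmetric idempotent matrices) such that (i) $\mathfrak P^{(n)}_1+\dots+\mathfrak P^{(n)}_4=(2-\frac1n)I_n$; (ii) $\operatorname{rk}\mathfrak P^{(n)}_1=\lfloor\frac n2\rfloor-(-1)^n$ and $\operatorname{rk}\mathfrak P^{(n)}_i=\lfloor\frac n2\rfloor$ for $i=2,3,4$; (iii) the only subspaces of $\mathbb C^n$ invariant under all four matrices are $0$ and $\mathbb C^n$. Such quadruples exist for every $n$, and any two of them are simultaneously unitarily equivalent. For $0\le r\le n$, $\mathfrak Q^{(n,r)}:=\frac12\big(I+\operatorname{sgn}((2r-\frac12)I-n(\mathfrak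 P^{(n)}_3+\mathfrak P^{(n)}_4))\big)$, a real orthogonal projection of rank $r$. *)

(* Defs.v *)
From HB Require Import structures.
From mathcomp Require Import all_boot all_order all_algebra.
From mathcomp Require Import reals.
From mathcomp Require Import complex mxtens.
From Stdlib Require Import ClassicalEpsilon.

Set Implicit Arguments.
Unset Strict Implicit.
Unset Printing Implicit Defensive.

Import Order.TTheory GRing.Theory Num.Theory.
Local Open Scope ring_scope.

Section QDefs.
Variable R : realType.
Local Notation C := R[i].

Definition adj {m n : nat} (A : 'M[C]_(m, n)) : 'M[C]_(n, m) :=
  (map_mx Num.conj A)^T.

Definition hermitian {n : nat} (A : 'M[C]_n) : Prop := adj A = A.

Definition psd {n : nat} (A : 'M[C]_n) : Prop :=
  hermitian A /\ forall v : 'cV[C]_n, 0 <= (adj v *m A *m v) 0 0.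
Definition pd {n : nat} (A : 'M[C]_n) : Prop :=
  hermitian A /\ forall v : 'cV[C]_n, v != 0 -> 0 < (adj v *m A *m v) 0 0.

Definition unit_vector {n : nat} (v : 'cV[C]_n) : Prop := adj v *m v = 1%:M.
Definition isometry {m n : nat} (U : 'M[C]_(m, n)) : Prop := adj U *m U = 1%:M.

Definition POVM {d k : nat} (M : 'I_k -> 'M[C]_d) : Prop :=
  (forall a, psd (M a)) /\ \sum_(a < k) M a = 1%:M.

(* A bipartite strategy with NA inputs for Alice, NB inputs for Bob and
   K outputs per input, on C^dA (x) C^dB (Kronecker product ordering,
   mxtens_index). *)
Record strategy (NA NB K : nat) := Strategy {
  dimA : nat;
  dimB : nat;
  state : 'cV[C]_(dimA * dimB);
  measA : 'I_NA -> 'I_K -> 'M[C]_dimA;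
  measB : 'I_NB -> 'I_K -> 'M[C]_dimB }.

Definition valid_strategy {NA NB K} (S : strategy NA NB K) : Prop :=
  unit_vector (state S) /\ (forall i, POVM (measA S i)) /\
  (forall j, POVM (measB S j)).

Definition correlation {NA NB K} (S : strategy NA NB K)
  (a b : 'I_K) (i : 'I_NA) (j : 'I_NB) : C :=
  (adj (state S) *m (measA S i a *t measB S j b) *m state S) 0 0.

Definition swap_mid {a b k l : nat} (w : 'cV[C]_((a * b) * (k * l))) :
    'cV[C]_((a * k) * (b * l)) :=
  \col_p (let: (p1, p2) := mxtens_unindex p in
          let: (x, y) := mxtens_unindex p1 in
          let: (z, t) := mxtens_unindex p2 in
          w (mxtens_index (mxtens_index (x, z), mxtens_index (y, t))) 0).

Definition local_dilation {NA NB K} (St S : strategy NA NB K) : Prop :=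
  exists (kA kB : nat) (aux : 'cV[C]_(kA * kB))
         (UA : 'M[C]_(dimA St * kA, dimA S)) (UB : 'M[C]_(dimB St * kB, dimB S)),
    [/\ unit_vector aux, isometry UA, isometry UB &
     forall i j a b,
       (UA *t UB) *m ((measA S i a *t measB S j b) *m state S) =
       swap_mid (((measA St i a *t measB St j b) *m state St) *t aux)].

Definition self_tested {NA NB K} (St : strategy NA NB K) : Prop :=
  forall S : strategy NA NB K, valid_strategy S ->
    (forall a b i j, correlation S a b i j = correlation St a b i j) ->
    local_dilation St S.

(* sgn of an (invertible Hermitian) matrix: the unique Hermitian unitary S
   commuting with X such that S X is positive definite (chosen by epsilon) *)
Definition sgn_spec {n : nat} (X S : 'M[C]_n) : Prop :=
  [/\ hermitian S, adj S *m S = 1%:M, S *m X = X *m S & pd (S *m X)].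
Definition sgn {n : nat} (X : 'M[C]_n) : 'M[C]_n :=
  epsilon (inhabits 0) (sgn_spec X).

Definition realC {m n : nat} (A : 'M[R]_(m, n)) : 'M[C]_(m, n) :=
  map_mx (real_complex R) A.

Definition phi (n : nat) : 'cV[C]_(n * n) :=
  \col_p (let: (i, j) := mxtens_unindex p in
          if i == j then real_complex R (Num.sqrt (n%:R : R))^-1 else 0).

(* the paper's projection frak Q^(n,r), built from frak P^(n)_3, P^(n)_4
   (0-based indices 2 and 3) *)
Definition frakQ (n r : nat) (P : 'I_4 -> 'M[R]_n) : 'M[C]_n :=
  2^-1 *: (1%:M + sgn (realC ((2 * r%:R - 2^-1 : R) *: 1%:M
                       - (n%:R : R) *: (P (inord 2) + P (inord 3))))).

Definition bin_meas {d : nat} (A : 'M[C]_d) : 'I_2 -> 'M[C]_d :=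
  fun a => if a == ord0 then A else 1%:M - A.

Definition S_nr (n r : nat) (P : 'I_4 -> 'M[R]_n) : strategy 5 4 2 :=
  @Strategy 5 4 2 n n (phi n)
    (fun i : 'I_5 => if (i < 4)%N then bin_meas (realC (P (inord i)))
                     else bin_meas (@frakQ n r P))
    (fun j : 'I_4 => bin_meas (realC (P j))).

End QDefs.

Arguments frakQ {R} n r P.
Arguments S_nr {R} n r P.
Arguments phi {R} n.

(* Main.v *)
Require Import Defs.
From HB Require Import structures.
From mathcomp Require Import all_boot all_order all_algebra.
From mathcomp Require Import reals.
From mathcomp Require Import complex mxtens.
From mathcomp Require Import spectral ring zify.
From Stdlib Require Import ClassicalEpsilon.

Import Order.TTheory GRing.Theory Num.Theory.
Local Open Scope ring_scope.

Set Implicit Arguments.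
Unset Strict Implicit.
Unset Printing Implicit Defensive.

(* Write the state of a strategy as a matrix [Psi], so that
   [(X (x) Y) psi] becomes [X *m Psi *m Y^T]. The correlation forces
   [A_i Psi = Psi B_i^T], hence the [A_i] act on the range of
   [rho = Psi Psi^*] as projections commuting with [rho] and summing to
   [2 - 1/n]. For two quadruples [P] and [M] of projections with the same
   scalar sum, [M_i T P_i = T P_i] for all [i] already forces
   [M_i T = T P_i], and these are few enough linear equations on [T] that a
   nonzero solution exists on some eigenspace of [rho], by the rank
   condition on the first projection. By irreducibility [T] is a multiple of
   an isometry; peeling such isometries off [rho] one after the other shows
   that [P] is the only irreducible quadruple occurring, and gives the local
   isometries, under which [Psi] becomes [1 (x) aux] by Schur's lemma.
   Finally [n (P_3 + P_4)] has integral eigenvalues, so the argument [H] of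
   [sgn] is invertible, and the fifth measurement is pinned down because its
   correlation with [H] is the largest possible, attained only by the
   positive spectral projection of [H]. *)

(* MathComp's sesquilinear forms shadow these two names. *)
Local Notation hermitian := Defs.hermitian.
Local Notation isometry := Defs.isometry.

(** * Adjoints, positive semidefinite matrices and spectral decompositions *)

Lemma mulmx_conj_diag (F : comPzRingType) n (U V : 'M[F]_n) (D E : 'rV[F]_n) :
  U *m V = 1%:M ->
  (V *m diag_mx D *m U) *m (V *m diag_mx E *m U) =
  V *m diag_mx (\row_j (D 0 j * E 0 j)) *m U.
Proof. by move=> UV; rewrite -mulmx_diag !mulmxA -(mulmxA _ U) UV mulmx1. Qed.

Section Adjoint.
Variable R : realType.
Local Notation C := R[i].

Lemma adjmxE m n (A : 'M[C]_(m, n)) i j : adj A i j = (A j i)^*.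
Proof. by rewrite !mxE. Qed.

Lemma adjmxK m n (A : 'M[C]_(m, n)) : adj (adj A) = A.
Proof. by apply/matrixP=> i j; rewrite !adjmxE conjCK. Qed.

Lemma adjmxM m n p (A : 'M[C]_(m, n)) (B : 'M[C]_(n, p)) :
  adj (A *m B) = adj B *m adj A.
Proof. by rewrite /adj map_mxM trmx_mul. Qed.

Lemma adjmxD m n (A B : 'M[C]_(m, n)) : adj (A + B) = adj A + adj B.
Proof. by rewrite /adj map_mxD linearD. Qed.

Lemma adjmxB m n (A B : 'M[C]_(m, n)) : adj (A - B) = adj A - adj B.
Proof. by rewrite /adj map_mxB linearB. Qed.

Lemma adjmxZ m n a (A : 'M[C]_(m, n)) : adj (a *: A) = a^* *: adj A.
Proof. by rewrite /adj map_mxZ linearZ. Qed.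

Lemma adjmx0 m n : adj (0 : 'M[C]_(m, n)) = 0.
Proof. by rewrite /adj map_mx0 trmx0. Qed.

Lemma adjmx1 n : adj (1%:M : 'M[C]_n) = 1%:M.
Proof. by rewrite /adj map_mx1 trmx1. Qed.

Lemma adj_trmx m n (A : 'M[C]_(m, n)) : adj A^T = (adj A)^T.
Proof. by apply/matrixP=> i j; rewrite !mxE. Qed.

Lemma adj_tens m n p q (A : 'M[C]_(m, n)) (B : 'M[C]_(p, q)) :
  adj (A *t B) = adj A *t adj B.
Proof. by rewrite /adj map_mxT trmx_tens. Qed.

Lemma adj_realC m n (A : 'M[R]_(m, n)) : adj (realC A) = realC A^T.
Proof. by apply/matrixP=> i j; rewrite !mxE conj_Creal // complex_real. Qed.

Lemma mxtrace_adj n (A : 'M[C]_n) : \tr (adj A) = (\tr A)^*.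
Proof. by rewrite /mxtrace rmorph_sum; apply: eq_bigr => i _; rewrite adjmxE. Qed.

Lemma mxtrace_adjM m n (A : 'M[C]_(m, n)) :
  \tr (adj A *m A) = \sum_j \sum_i `|A i j| ^+ 2.
Proof.
apply: eq_bigr => j _; rewrite mxE; apply: eq_bigr => i _.
by rewrite adjmxE normCKC.
Qed.

Lemma mxtrace_adjM_ge0 m n (A : 'M[C]_(m, n)) : 0 <= \tr (adj A *m A).
Proof.
rewrite mxtrace_adjM sumr_ge0 // => j _.
by rewrite sumr_ge0 // => i _; rewrite exprn_ge0.
Qed.

Lemma mxtrace_adjM_eq0 m n (A : 'M[C]_(m, n)) : \tr (adj A *m A) = 0 -> A = 0.
Proof.
rewrite mxtrace_adjM => /eqP; rewrite psumr_eq0; last first.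
  by move=> j _; rewrite sumr_ge0 // => i _; rewrite exprn_ge0.
move=> /allP A0; apply/matrixP=> i j.
have := A0 j (mem_index_enum _); rewrite /= psumr_eq0; last first.
  by move=> k _; rewrite exprn_ge0.
move=> /allP /(_ i (mem_index_enum _)) /=.
by rewrite mxE expf_eq0 /= normr_eq0 => /eqP.
Qed.

Lemma hermitian_spectral n (A : 'M[C]_n) : hermitian A ->
  exists (U : 'M[C]_n) (D : 'rV[C]_n),
    [/\ U *m adj U = 1%:M, adj U *m U = 1%:M & A = adj U *m diag_mx D *m U].
Proof.
move=> hA.
have : A \is normalmx by apply/normalmxP; rewrite -map_trmx -/(adj A) hA.
move/orthomx_spectralP; set U := spectralmx A => eA.
have uU : U \is unitarymx by apply: spectral_unitarymx.
have UU : U *m adj U = 1%:M by move/unitarymxP: uU; rewrite -map_trmx.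
have UV : invmx U = adj U by rewrite invmx_unitary // -map_trmx.
exists U, (spectral_diag A); split; [exact: UU|exact: mulmx1C|].
exact: etrans eA (congr1 (fun V => V *m diag_mx (spectral_diag A) *m U) UV).
Qed.

Lemma psd_spectral n (A : 'M[C]_n) : psd A ->
  exists (U : 'M[C]_n) (D : 'rV[C]_n),
    [/\ U *m adj U = 1%:M, adj U *m U = 1%:M, A = adj U *m diag_mx D *m U &
        forall i, 0 <= D 0 i].
Proof.
move=> [hA pA]; have [U [D [UU UU' eA]]] := hermitian_spectral hA.
exists U, D; split=> // i.
have := pA (adj U *m delta_mx i 0).
rewrite eA adjmxM adjmxK !mulmxA -(mulmxA _ U (adj U)) UU mulmx1.
rewrite -(mulmxA _ U (adj U)) UU mulmx1.
suff -> : adj (delta_mx i 0 : 'cV[C]_n) = delta_mx 0 i.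
  by rewrite -rowE -colE !mxE eqxx mulr1n.
by apply/matrixP=> a b; rewrite !mxE andbC; case: andb; rewrite ?conjC1 ?conjC0.
Qed.

Lemma adj_diag n (D : 'rV[C]_n) : adj (diag_mx D) = diag_mx (map_mx Num.conj D).
Proof. by rewrite /adj map_diag_mx tr_diag_mx. Qed.

Lemma psd_factor n (A : 'M[C]_n) : psd A -> exists B : 'M[C]_n, A = adj B *m B.
Proof.
move=> /psd_spectral [U [D [_ _ -> D_ge0]]].
exists (diag_mx (map_mx sqrtC D) *m U); rewrite adjmxM adj_diag.
rewrite !mulmxA -(mulmxA _ (diag_mx _) (diag_mx _)) mulmx_diag.
congr (_ *m diag_mx _ *m _); apply/rowP=> i; rewrite !mxE.
rewrite conj_Creal -?expr2 ?sqrtCK // ger0_real // sqrtC_ge0; exact: D_ge0.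
Qed.

Lemma mxtrace11 (A : 'M[C]_1) : \tr A = A 0 0.
Proof. by rewrite /mxtrace big_ord1. Qed.

Lemma psd_adjM m n (B : 'M[C]_(m, n)) : psd (adj B *m B).
Proof.
split; first by rewrite /hermitian adjmxM adjmxK.
by move=> v; rewrite mulmxA -adjmxM -mulmxA -mxtrace11 mxtrace_adjM_ge0.
Qed.

Lemma psd_trmx n (A : 'M[C]_n) : psd A -> psd A^T.
Proof.
move=> [hA pA]; split; first by rewrite /hermitian adj_trmx hA.
move=> v; have := pA (adj v)^T.
suff -> : (adj (adj v)^T *m A *m (adj v)^T) = (adj v *m A^T *m v)^T by rewrite mxE.
by rewrite adj_trmx adjmxK !trmx_mul (trmxK A) mulmxA.
Qed.

(** With [A = adj a *m a] and [B = adj b *m b], the trace is the squared Frobenius norm of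
    [a *m X *m adj b]. For effects [A], [B] and the matrix [X] of a state it is an outcome
    probability, so a vanishing probability becomes an operator identity. *)
Lemma mxtrace_psd_sandwich m n (A : 'M[C]_m) (B : 'M[C]_n) (X : 'M[C]_(m, n)) :
  psd A -> psd B ->
  0 <= \tr (adj X *m A *m X *m B) /\
  (\tr (adj X *m A *m X *m B) = 0 -> A *m X *m B = 0).
Proof.
move=> /psd_factor [a ->] /psd_factor [b ->].
have -> : \tr (adj X *m (adj a *m a) *m X *m (adj b *m b)) =
          \tr (adj (a *m X *m adj b) *m (a *m X *m adj b)).
  by rewrite !adjmxM adjmxK [in LHS]mulmxA mxtrace_mulC !mulmxA.
split; first exact: mxtrace_adjM_ge0.
move/mxtrace_adjM_eq0 => aXb.
by rewrite -!mulmxA (mulmxA X) (mulmxA a) (mulmxA a) aXb mul0mx mulmx0.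
Qed.

(** [E l] is diagonal in an eigenbasis, with the indicator of the eigenvalue [l] as diagonal; it
    vanishes when [l] is not an eigenvalue. The last clause makes every matrix commuting with [A]
    act on each eigenspace. *)
Lemma psd_eigenprojections n (A : 'M[C]_n) : psd A ->
  exists (s : seq C) (E : C -> 'M[C]_n),
  [/\ forall l, l \in s -> 0 <= l,
      A = \sum_(l <- s) l *: E l,
      forall l, hermitian (E l) /\ E l *m E l = E l,
      forall l, A *m E l = l *: E l &
      forall l X, X *m A = A *m X -> X *m E l = E l *m X].
Proof.
move=> /psd_spectral [U [D [UU UU' eA D_ge0]]].
pose ind (l : C) : 'rV[C]_n := map_mx (fun x => (x == l)%:R) D.
pose E (l : C) := adj U *m diag_mx (ind l) *m U.
have mulE (F G : 'rV[C]_n) := mulmx_conj_diag F G UU.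
(* [undup] lists each eigenvalue once, since [E l] already covers the whole eigenspace. *)
exists (undup [seq D 0 i | i <- enum 'I_n]), E; split.
- by move=> l; rewrite mem_undup => /mapP [i _ ->].
- rewrite eA /E; under eq_bigr => l _ do rewrite scalemxAl scalemxAr.
  rewrite -mulmx_suml -mulmx_sumr; congr (_ *m _ *m _).
  apply/matrixP=> i j; rewrite summxE mxE.
  have -> : D 0 i = \sum_(l <- undup [seq D 0 i | i <- enum 'I_n]) l * (D 0 i == l)%:R.
    rewrite (bigD1_seq (D 0 i)) ?undup_uniq //=; last first.
      by rewrite mem_undup map_f // mem_enum.
    rewrite eqxx mulr1 big1 ?addr0 // => l; rewrite eq_sym => /negPf ->.
    by rewrite mulr0.
  rewrite -sumrMnl; apply: eq_bigr => l _; rewrite !mxE.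
  by rewrite -mulrnAr.
- move=> l; split.
    rewrite /hermitian /E !adjmxM adjmxK adj_diag mulmxA; congr (_ *m diag_mx _ *m _).
    by apply/rowP=> i; rewrite !mxE conjC_nat.
  rewrite /E mulE; congr (_ *m diag_mx _ *m _).
  by apply/rowP=> i; rewrite !mxE; case: eqP => _; rewrite ?mulr1 ?mulr0.
- move=> l; rewrite eA /E mulE scalemxAl scalemxAr; congr (_ *m _ *m _).
  rewrite -linearZ; congr diag_mx.
  by apply/rowP=> i; rewrite !mxE; case: eqP => [->|_]; rewrite ?mulr1 ?mulr0.
- move=> l X XA.
  have XA' : U *m X *m adj U *m diag_mx D = diag_mx D *m (U *m X *m adj U).
    have := congr1 (fun Y => U *m Y *m adj U) XA; rewrite {}eA.
    by rewrite !mulmxA UU mul1mx -(mulmxA _ U (adj U)) UU mulmx1 => ->.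
  (* In the eigenbasis, a matrix commuting with [A] has zero entries between distinct
     eigenvalues. *)
  have XE : U *m X *m adj U *m diag_mx (ind l) = diag_mx (ind l) *m (U *m X *m adj U).
    apply/matrixP=> i j; move/matrixP/(_ i j): XA'.
    rewrite !mul_mx_diag !mul_diag_mx !mxE.
    have [<-|nD] := eqVneq (D 0 i) (D 0 j); first by rewrite ![_ * (_)%:R]mulrC.
    rewrite [X in _ = X]mulrC => /eqP; rewrite -subr_eq0 -mulrBr mulf_eq0.
    rewrite subr_eq0 [D 0 j == _]eq_sym (negPf nD) orbF => /eqP ->.
    by rewrite mulr0 mul0r.
  have := congr1 (fun Y => adj U *m Y *m U) XE.
  by rewrite /E !mulmxA UU' mul1mx -(mulmxA _ (adj U) U) UU' mulmx1.
Qed.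

End Adjoint.

(** * Ranks, traces of idempotents and counting of linear equations *)

Section LinearSystems.
Variable F : fieldType.

(** In a full-rank factorisation [A = c *m r], idempotence forces [r *m c = 1%:M], and the trace is
    cyclic. *)
Lemma mxtrace_idem n (A : 'M[F]_n) : A *m A = A -> \tr A = (\rank A)%:R.
Proof.
move=> AA.
have := (mulmx_base A, row_base_free A, col_base_full A).
case=> -[]; move: (col_base A) (row_base A) => c r cr r_free c_full.
have rc : r *m c = 1%:M.
  apply: (row_free_inj r_free); apply: (row_full_inj c_full).
  by rewrite mul1mx !mulmxA cr -mulmxA cr.
by rewrite -{1}cr mxtrace_mulC rc mxtrace1.
Qed.

(** Full-rank factorisations of [L] and [Q] make the map factor through the matrices of size
    [\rank L] by [\rank Q]. *)
Lemma mxrank_sandwich m n (L : 'M[F]_m) (Q : 'M[F]_n) :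
  (\rank (lin_mx (mulmxr Q \o mulmx L : 'M_(m, n) -> 'M_(m, n))) <= \rank L * \rank Q)%N.
Proof.
have := (mulmx_base L, mulmx_base Q).
case; move: (col_base L) (row_base L) (col_base Q) (row_base Q) => c r c' r' cr cr'.
have -> : lin_mx (mulmxr Q \o mulmx L : 'M_(m, n) -> 'M_(m, n)) =
  lin_mx (mulmxr c' \o mulmx r) *m lin_mx (mulmxr r' \o mulmx c).
  apply/row_matrixP=> i; rewrite !rowE mulmxA !mul_rV_lin /= mxvecK.
  by rewrite !mulmxA cr -(mulmxA _ c') cr'.
exact: mulmx_max_rank.
Qed.

(* Fewer scalar equations than unknowns: [L *m T *m Q = 0] amounts to
   [\rank L * \rank Q] of them. *)
Lemma sandwich_system_solution m n (s : seq ('M[F]_m * 'M[F]_n)) :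
  (\sum_(c <- s) \rank c.1 * \rank c.2 < m * n)%N ->
  exists2 T : 'M[F]_(m, n), T != 0 & forall c, c \in s -> c.1 *m T *m c.2 = 0.
Proof.
move=> lt_s.
pose lin (c : 'M[F]_m * 'M[F]_n) :=
  lin_mx (mulmxr c.2 \o mulmx c.1 : 'M_(m, n) -> 'M_(m, n)).
(* [V] is the intersection of the kernels; each constraint lowers its dimension by at most the rank
   of that constraint. *)
have [V rV VK] : exists2 V : 'M[F]_(m * n),
  (m * n <= \rank V + \sum_(c <- s) \rank c.1 * \rank c.2)%N &
  forall c, c \in s -> (V <= kermx (lin c))%MS.
  elim: s {lt_s} => [|c s [V rV VK]].
    by exists 1%:M => //; rewrite mxrank1 leq_addr.
  exists (V :&: kermx (lin c))%MS.
    rewrite big_cons; have := mxrank_sum_cap V (kermx (lin c)).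
    rewrite mxrank_ker; have := rank_leq_row (V + kermx (lin c))%MS.
    have := rank_leq_row (lin c); have := mxrank_sandwich c.1 c.2; rewrite -/(lin c).
    by move: rV; set S := (\sum_(_ <- _) _)%N; lia.
  move=> d; rewrite inE => /orP [/eqP ->|/VK]; first exact: capmxSr.
  exact: submx_trans (capmxSl _ _).
have /rowV0Pn [v vV v0] : V != 0.
  by apply: contraTneq lt_s => V0; move: rV; rewrite V0 mxrank0 add0n -leqNgt.
exists (vec_mx v) => [|c cs].
  by apply: contra v0 => /eqP v0; rewrite -(vec_mxK v) v0 linear0.
have /sub_kermxP := submx_trans vV (VK c cs).
by rewrite /lin mul_rV_lin /= => /(congr1 vec_mx); rewrite mxvecK linear0.
Qed.

End LinearSystems.

(** The right side is the number of unknowns minus the number of equations in the system of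
    [intertwiner_exists], with [u = 1/n], [x = \tr E], [yi = \tr (M i *m E)]. After elimination of
    [y3] the two sides differ by [x] times the defect of the first hypothesis. *)
Lemma count_identity (F : comNzRingType) (m n f u e x y0 y1 y2 y3 : F) :
  f * u * (1 + e) = n + e - 2 * f ->
  y0 + (y1 + (y2 + (y3 + 0))) = (2 - u) * x ->
  e * (f * u * x - y0) =
  m * n - ((m - x) * n + (x * f - y0 * f - (x - y0) * (e * 1) +
    (x * f - y1 * f - (x - y1) * (e * 0) + (x * f - y2 * f - (x - y2) * (e * 0) +
    (x * f - y3 * f - (x - y3) * (e * 0) + 0))))).
Proof.
move=> fu y_sum.
have -> : y3 = (2 - u) * x - y0 - y1 - y2 by rewrite -y_sum; ring.
apply/eqP; rewrite -subr_eq0; apply/eqP.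
transitivity (x * (f * u * (1 + e) - (n + e - 2 * f))); first by ring.
by rewrite fu subrr mulr0.
Qed.

(** * Intertwiners between two quadruples with the same scalar sum *)

Section Intertwiners.
Variable R : realType.
Local Notation C := R[i].
Variables (n : nat) (P : 'I_4 -> 'M[C]_n) (a : C).
Hypothesis P_herm : forall i, hermitian (P i).
Hypothesis P_idem : forall i, P i *m P i = P i.
Hypothesis P_sum : \sum_i P i = a *: 1%:M.

(* Summing [\tr (adj D *m D)] over [D := M i *m T - T *m P i] telescopes to
   [a \tr (adj T *m T) - a \tr (adj T *m T) = 0]. *)
Lemma intertwiner_of_half m (M : 'I_4 -> 'M[C]_m) (T : 'M[C]_(m, n)) :
  (forall i, hermitian (M i)) -> (forall i, M i *m (M i *m T) = M i *m T) ->
  \sum_i M i *m T = a *: T -> (forall i, M i *m T *m P i = T *m P i) ->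
  forall i, M i *m T = T *m P i.
Proof.
move=> M_herm M_idem M_sum MTP.
have sqr i : \tr (adj (M i *m T - T *m P i) *m (M i *m T - T *m P i)) =
   \tr (adj T *m (M i *m T)) - \tr (adj T *m (T *m P i)).
  rewrite adjmxB !adjmxM M_herm P_herm mulmxBl !mulmxBr.
  have e1 : adj T *m M i *m (M i *m T) = adj T *m (M i *m T).
    by rewrite -mulmxA M_idem.
  have e2 : adj T *m M i *m (T *m P i) = adj T *m (T *m P i).
    by rewrite -mulmxA (mulmxA (M i)) MTP.
  have e3 : P i *m adj T *m (M i *m T) = P i *m adj T *m T.
    have := congr1 (@adj R _ _) (MTP i); rewrite !adjmxM M_herm P_herm => e.
    by rewrite !mulmxA -(mulmxA _ (adj T)) e.
  have e4 : \tr (P i *m adj T *m (T *m P i)) = \tr (P i *m adj T *m T).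
    by rewrite mulmxA mxtrace_mulC !mulmxA P_idem.
  have e5 : \tr (P i *m adj T *m T) = \tr (adj T *m (T *m P i)).
    by rewrite -mulmxA mxtrace_mulC mulmxA.
  by rewrite e1 e2 e3 !raddfB /= e4 e5 opprK addNr addr0.
have : \sum_i \tr (adj (M i *m T - T *m P i) *m (M i *m T - T *m P i)) = 0.
  under eq_bigr => i _ do rewrite sqr.
  rewrite sumrB -!raddf_sum /= M_sum P_sum.
  by rewrite -!scalemxAr mulmx1 subrr.
move/eqP; rewrite psumr_eq0 => [|i _]; last exact: mxtrace_adjM_ge0.
move=> /allP D0 j; apply/eqP; rewrite -subr_eq0; apply/eqP.
by apply: mxtrace_adjM_eq0; apply/eqP/D0; rewrite mem_index_enum.
Qed.

Variables (f e : C).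
Hypothesis n_gt0 : (0 < n)%N.
Hypothesis a_def : a = 2 - n%:R^-1.
Hypothesis e_sqr : e ^+ 2 = 1.
Hypothesis P_tr : forall i, \tr (P i) = f - e * (i == ord0)%:R.

Let n0 : n%:R != 0 :> C. Proof. by rewrite pnatr_eq0 -lt0n. Qed.

(** Traces in [P_sum] give [4 f - e = 2 n - 1]. *)
Lemma rank_defect_eq : e = 4 * f - 2 * n%:R + 1.
Proof.
have := congr1 mxtrace P_sum; rewrite raddf_sum /= linearZ /= mxtrace1 a_def.
under eq_bigr => i _ do rewrite P_tr.
rewrite !big_ord_recl big_ord0 /= mulr1 !mulr0 !subr0 addr0.
rewrite mulrBl mulVf // => h.
have -> : 4 * f - 2 * n%:R + 1 = 4 * f - (2 * n%:R - 1) by ring.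
rewrite -h; ring.
Qed.

(** Multiplied by [4 n], the relation reads [e ^+ 2 = 1] once [e] is replaced by its value from
    [rank_defect_eq]. The exact ranks enter the dimension count through it. *)
Lemma rank_relation : f * n%:R^-1 * (1 + e) = n%:R + e - 2 * f.
Proof.
apply: (mulIf n0); rewrite mulrAC -(mulrA f) mulVf // mulr1.
move: e_sqr; rewrite rank_defect_eq => /eqP; rewrite -subr_eq0 => /eqP e2.
apply/eqP; rewrite -subr_eq0; apply/eqP.
apply: (mulfI (x := 4)); first by rewrite pnatr_eq0.
by rewrite mulr0 -[RHS]e2; ring.
Qed.

(** The unknown [T] is subject to [(1 - E) T = 0] and [(E - M i E) T (P i) = 0]. The coefficients
    are projections, so their ranks are traces, and by [count_identity] the unknowns outnumber the
    equations by exactly the quantity assumed positive. A solution satisfies the hypothesis of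
    [intertwiner_of_half]. *)
Lemma intertwiner_exists m (M : 'I_4 -> 'M[C]_m) (E : 'M[C]_m) :
  (forall i, hermitian (M i)) -> hermitian E -> E *m E = E ->
  (forall i, M i *m E = E *m M i) ->
  (forall i, M i *m (M i *m E) = M i *m E) ->
  \sum_i M i *m E = a *: E ->
  0 < e * (f / n%:R * \tr E - \tr (M ord0 *m E)) ->
  exists T : 'M[C]_(m, n), [/\ T != 0, E *m T = T & forall i, M i *m T = T *m P i].
Proof.
move=> M_herm E_herm E_idem ME M_idem M_sum gt0.
have idE : (1%:M - E) *m (1%:M - E) = 1%:M - E.
  by rewrite mulmxBl mul1mx mulmxBr mulmx1 E_idem subrr subr0.
(* [M i] is idempotent only on the range of [E], which is enough for [E - M i *m E] to be a
   projection. *)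
have idME i : (E - M i *m E) *m (E - M i *m E) = E - M i *m E.
  have EME : E *m (M i *m E) = M i *m E by rewrite mulmxA -ME -mulmxA E_idem.
  by rewrite mulmxBl !mulmxBr -!(mulmxA (M i)) EME E_idem M_idem subrr subr0.
have tr_sum : \sum_i \tr (M i *m E) = a * \tr E.
  by rewrite -raddf_sum M_sum /= linearZ.
have [|T T0 sol] := @sandwich_system_solution _ m n
  ((1%:M - E, 1%:M) :: [seq (E - M i *m E, P i) | i <- enum 'I_4]).
- rewrite -(ltr_nat C) big_cons big_map big_enum /= natrD natr_sum natrM.
  rewrite -mxtrace_idem // mxrank1 raddfB /= mxtrace1.
  under eq_bigr => i _.
    rewrite natrM -!mxtrace_idem // P_tr raddfB /= mulrBr mulrBl.
    over.
  move: gt0 tr_sum; rewrite !big_ord_recl !big_ord0 /= a_def; set x := \tr E.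
  set y0 := \tr (M ord0 *m E); set y1 := \tr (M (lift _ _) *m E).
  set y2 := \tr (M (lift _ (lift _ _)) *m E).
  set y3 := \tr (M (lift _ _) *m E).
  move=> gt0 y_sum; rewrite -subr_gt0; congr (0 < _): gt0.
  have := rank_relation.
  set u := n%:R^-1 in y_sum * => fu; rewrite natrM.
  exact: count_identity.
have ET : E *m T = T.
  apply/esym; have := sol _ (mem_head _ _); rewrite /= mulmx1 mulmxBl mul1mx => /eqP.
  by rewrite subr_eq0 => /eqP.
exists T; split=> //; apply: intertwiner_of_half => // [i||i].
- by rewrite -ET (mulmxA (M i) E) (mulmxA (M i)) M_idem.
- rewrite -[in RHS]ET scalemxAl -M_sum mulmx_suml.
  by apply: eq_bigr => i _; rewrite -mulmxA ET.
have /sol /= : (E - M i *m E, P i) \in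
    (1%:M - E, 1%:M) :: [seq (E - M i *m E, P i) | i <- enum 'I_4].
  by rewrite in_cons; apply/orP; right; apply/mapP; exists i; rewrite ?mem_enum.
by rewrite !mulmxBl -!(mulmxA (M i)) ET => /eqP; rewrite subr_eq0 => /eqP.
Qed.

End Intertwiners.

(** * Decomposition of the range of [rho] into copies of [P] *)

Section Decomposition.
Variable R : realType.
Local Notation C := R[i].
Variables (n : nat) (P : 'I_4 -> 'M[C]_n) (a f e : C).
Hypothesis P_herm : forall i, hermitian (P i).
Hypothesis P_idem : forall i, P i *m P i = P i.
Hypothesis P_sum : \sum_i P i = a *: 1%:M.
Hypothesis n_gt0 : (0 < n)%N.
Hypothesis a_def : a = 2 - n%:R^-1.
Hypothesis e_sqr : e ^+ 2 = 1.
Hypothesis P_tr : forall i, \tr (P i) = f - e * (i == ord0)%:R.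
Hypothesis P_schur : forall X : 'M[C]_n, (forall i, X *m P i = P i *m X) ->
  exists c : C, X = c%:M.

Lemma mxtrace_hermitian_real m (A : 'M[C]_m) : hermitian A -> \tr A \is Num.real.
Proof. by move=> hA; apply/CrealP; rewrite -mxtrace_adj hA. Qed.

Lemma mxtrace_psd_gt0 m (A : 'M[C]_m) : psd A -> A != 0 -> 0 < \tr A.
Proof.
move=> /psd_factor [B ->] A0; rewrite lt0r mxtrace_adjM_ge0 andbT.
by apply: contra A0 => /eqP /mxtrace_adjM_eq0 ->; rewrite mulmx0.
Qed.

Lemma hermitian_mul_comm m (A E : 'M[C]_m) :
  hermitian A -> hermitian E -> A *m E = E *m A -> hermitian (A *m E).
Proof. by move=> hA hE AE; rewrite /hermitian adjmxM hA hE. Qed.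

(** What the correlation says about the measurements [M] on the range of a reduced state [rho]. The
    relations are multiplied by [rho] because nothing is known off its range; [like_tr] is the
    normalised trace of [P ord0]. *)
Record P_like m (M : 'I_4 -> 'M[C]_m) (rho : 'M[C]_m) : Prop := PLike {
  like_psd : psd rho;
  like_comm : forall i, M i *m rho = rho *m M i;
  like_idem : forall i, M i *m (M i *m rho) = M i *m rho;
  like_sum : \sum_i M i *m rho = a *: rho;
  like_tr : \tr (M ord0 *m rho) = (f - e) / n%:R * \tr rho }.

Section Fixed.
Variables (m : nat) (M : 'I_4 -> 'M[C]_m).
Hypothesis M_herm : forall i, hermitian (M i).

(* Averaging the count of [intertwiner_exists] over the eigenspaces of [rho],
   weighted by the eigenvalues, gives [e ^+ 2 / n * \tr rho > 0]. *)
Lemma isometric_intertwiner_exists rho : P_like M rho -> rho != 0 ->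
  exists (T : 'M[C]_(m, n)) (l : C), [/\ 0 < l, isometry T, rho *m T = l *: T &
    forall i, M i *m T = T *m P i].
Proof.
move=> [rho_psd Mrho M_idem M_sum M_tr] rho0.
have [s [E [s_ge0 rhoE E_proj rho_E E_comm]]] := psd_eigenprojections rho_psd.
have ME l i : M i *m E l = E l *m M i by apply: E_comm.
have f_real : f \is Num.real.
  have /mxtrace_hermitian_real := P_herm (lift ord0 ord0).
  by rewrite P_tr mulr0 subr0.
have e_real : e \is Num.real.
  have /mxtrace_hermitian_real := P_herm ord0; rewrite P_tr eqxx mulr1 => h.
  by rewrite -(subKr f e) rpredB.
(* [w l] is the excess of unknowns over equations when [intertwiner_exists] is applied to the
   eigenspace of [l]. *)
pose w l := e * (f / n%:R * \tr (E l) - \tr (M ord0 *m E l)).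
have w_real l : w l \is Num.real.
  have [hE _] := E_proj l.
  rewrite realM // realB ?realM ?realV ?realn ?mxtrace_hermitian_real //.
  exact: hermitian_mul_comm.
have w_sum : \sum_(l <- s) l * w l = n%:R^-1 * \tr rho.
  transitivity (e * (f / n%:R * \tr rho - \tr (M ord0 *m rho))); last first.
    rewrite M_tr; rewrite -[RHS]mul1r -e_sqr; ring.
  rewrite [in RHS]rhoE mulmx_sumr !(raddf_sum (@mxtrace _ m)) /= mulr_sumr -sumrB mulr_sumr.
  apply: eq_bigr => l _; rewrite -scalemxAr !mxtraceZ /w.
  by rewrite mulrCA mulrBr mulrCA; ring.
have [l ls w_gt0] : exists2 l, l \in s & 0 < l * w l.
  have [/hasP[l ls lt]|/hasPn s_le] := boolP (has (fun l => 0 < l * w l) s).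
    by exists l.
  have : 0 < \sum_(l <- s) l * w l.
    by rewrite w_sum mulr_gt0 ?mxtrace_psd_gt0 // invr_gt0 ltr0n.
  suff /le_gtF -> : \sum_(l <- s) l * w l <= 0 by [].
  rewrite big_seq sumr_le0 // => l ls; have := s_le l ls.
  have l_real : (l : C) \is Num.real by rewrite ger0_real ?s_ge0.
  by rewrite -real_leNgt ?real0 ?(realM l_real (w_real l)).
have l_gt0 : 0 < l.
  rewrite lt0r s_ge0 // andbT; apply: contraTneq w_gt0 => ->.
  by rewrite mul0r ltxx.
rewrite pmulr_rgt0 // in w_gt0.
have l0 : l != 0 by rewrite gt_eqF.
(* As [l] is nonzero, this identity passes the relations from [rho] to its eigenprojection [E l]. *)
have EM X : l *: (X *m E l) = X *m rho *m E l.
  by rewrite scalemxAr -rho_E mulmxA.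
have [E_herm E_idem] := E_proj l.
have [||T [T0 ET MT]] :=
  intertwiner_exists P_herm P_idem P_sum n_gt0 a_def e_sqr P_tr
    M_herm E_herm E_idem (ME l) _ _ w_gt0.
- move=> i; apply: (scalerI l0); rewrite mulmxA !EM -(mulmxA (M i)) M_idem.
  by [].
- apply: (scalerI l0); rewrite scaler_sumr.
  under eq_bigr => i _ do rewrite EM.
  by rewrite -mulmx_suml M_sum -scalemxAl rho_E scalerA mulrC scalerA.
(* [adj T *m T] commutes with every [P i], so it is a scalar by Schur's lemma, and [T] divided by
   the square root of that scalar is an isometry. *)
have [c Tc] : exists c : C, adj T *m T = c%:M.
  apply: P_schur => i; rewrite -mulmxA -MT.
  have := congr1 (@adj R _ _) (MT i); rewrite !adjmxM M_herm P_herm => h.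
  by rewrite (mulmxA (P i)) -h mulmxA.
have c_gt0 : 0 < c.
  have : 0 < \tr (adj T *m T).
    rewrite lt0r mxtrace_adjM_ge0 andbT.
    by apply: contra T0 => /eqP /mxtrace_adjM_eq0 ->.
  by rewrite Tc mxtrace_scalar -mulr_natr pmulr_lgt0 // ltr0n.
exists ((sqrtC c)^-1 *: T), l; split=> //.
- rewrite /isometry adjmxZ -scalemxAl -scalemxAr Tc scalerA scale_scalar_mx.
  rewrite fmorphV /= conj_Creal ?ger0_real ?sqrtC_ge0 ?ltW //.
  by rewrite -invfM -expr2 sqrtCK mulVf // gt_eqF.
- by rewrite -scalemxAr -ET mulmxA rho_E -scalemxAl scalerA mulrC -scalerA.
- by move=> i; rewrite -scalemxAr MT -scalemxAl.
Qed.

(** Every condition but positivity is linear in [rho] and holds for [T *m adj T] because it holds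
    for [P]. Positivity survives because the difference is the compression of [rho] by the
    projection [1 - T *m adj T]. *)
Lemma P_like_peel (rho : 'M[C]_m) (T : 'M[C]_(m, n)) (l : C) :
  P_like M rho -> 0 < l -> isometry T -> rho *m T = l *: T ->
  (forall i, M i *m T = T *m P i) -> P_like M (rho - l *: (T *m adj T)).
Proof.
move=> [rho_psd Mrho M_idem M_sum M_tr] l_gt0 T_iso rhoT MT.
have TM i : adj T *m M i = P i *m adj T.
  by have := congr1 (@adj R _ _) (MT i); rewrite !adjmxM M_herm P_herm.
have Trho : adj T *m rho = l *: adj T.
  have := congr1 (@adj R _ _) rhoT; rewrite adjmxM adjmxZ; case: rho_psd => -> _.
  by rewrite conj_Creal // gtr0_real.
have rho'E : rho - l *: (T *m adj T) =
    (1%:M - T *m adj T) *m rho *m (1%:M - T *m adj T).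
  rewrite mulmxBl mul1mx -(mulmxA T) Trho -scalemxAr mulmxBr mulmx1.
  rewrite mulmxBl -scalemxAl -mulmxA (mulmxA (adj T)) T_iso mul1mx.
  by rewrite mulmxA rhoT -!scalemxAl subrr subr0.
split.
- rewrite rho'E; have [B ->] := psd_factor rho_psd.
  have : adj (1%:M - T *m adj T) = 1%:M - T *m adj T.
    by rewrite adjmxB adjmx1 adjmxM adjmxK.
  set X := 1%:M - _ => XX; rewrite -{1}XX !mulmxA -adjmxM -mulmxA.
  exact: psd_adjM.
- move=> i; rewrite mulmxBr mulmxBl Mrho; congr (_ - _).
  by rewrite -scalemxAr -scalemxAl mulmxA MT -!mulmxA TM.
- move=> i; rewrite !mulmxBr M_idem -!scalemxAr.
  have -> : M i *m (T *m adj T) = T *m (P i *m adj T) by rewrite mulmxA MT mulmxA.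
  by rewrite (mulmxA (M i)) MT -(mulmxA T) (mulmxA (P i)) P_idem.
- under eq_bigr => i _ do rewrite mulmxBr -scalemxAr mulmxA MT.
  rewrite sumrB M_sum -scaler_sumr -mulmx_suml -mulmx_sumr P_sum.
  by rewrite -scalemxAr mulmx1 -scalemxAl scalerBr !scalerA mulrC.
- rewrite mulmxBr !raddfB /= M_tr mulrBr; congr (_ - _).
  rewrite -scalemxAr !linearZ /= mulmxA MT mxtrace_mulC mulmxA T_iso mul1mx.
  rewrite mxtrace_mulC T_iso mxtrace1 P_tr eqxx mulr1.
  by rewrite mulrCA mulfVK // pnatr_eq0 -lt0n.
Qed.

(** The row space of the difference lies in that of [rho]. If they were equal, [rho] would kill [T]
    as the difference does, against [rho *m T = l *: T] with [l > 0] and [T] nonzero. *)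
Lemma rank_peel (rho : 'M[C]_m) (T : 'M[C]_(m, n)) (l : C) :
  hermitian rho -> 0 < l -> isometry T -> rho *m T = l *: T ->
  (\rank (rho - l *: (T *m adj T))%R < \rank rho)%N.
Proof.
move=> rho_herm l_gt0 T_iso rhoT.
have Trho : adj T *m rho = l *: adj T.
  have := congr1 (@adj R _ _) rhoT; rewrite adjmxM adjmxZ rho_herm.
  by rewrite conj_Creal // gtr0_real.
set r' := _ - _.
have r'E : r' = (1%:M - T *m adj T) *m rho.
  by rewrite mulmxBl mul1mx -mulmxA Trho -scalemxAr.
have r'_le : (r' <= rho)%MS by rewrite r'E submxMl.
rewrite ltn_neqAle mxrankS // andbT; apply/negP => /eqP rr.
have /submxP [X rhoX] : (rho <= r')%MS by rewrite -(mxrank_leqif_sup r'_le) rr.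
have : rho *m T = 0.
  rewrite rhoX -mulmxA mulmxBl rhoT -scalemxAl -mulmxA T_iso mulmx1 subrr.
  by rewrite mulmx0.
rewrite rhoT => /eqP; rewrite scaler_eq0 gt_eqF //= => /eqP T0.
move: T_iso; rewrite /isometry T0 mulmx0 => /(congr1 mxtrace) /eqP.
by rewrite mxtrace0 mxtrace1 eq_sym pnatr_eq0 -leqn0 leqNgt n_gt0.
Qed.

(** Induction on the rank, peeling one isometry [T0] at a time. The clause placing [T s] in the
    range of [rho] serves the induction: the remainder kills [T0], so isometries with range inside
    that of the remainder are orthogonal to [T0]. The last clause says that the copies of [P]
    exhaust the range of [rho]. *)
Lemma isotypic_decomposition rho : P_like M rho ->
  exists (k : nat) (T : 'I_k -> 'M[C]_(m, n)),
  [/\ forall s t, adj (T s) *m T t = (s == t)%:R%:M,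
      forall s i, M i *m T s = T s *m P i,
      forall s, exists Y, T s = rho *m Y &
      \sum_s T s *m adj (T s) *m rho = rho].
Proof.
have [N] := ubnP (\rank rho); elim: N rho => // N IH rho rN rho_like.
have [->|rho0] := eqVneq rho 0.
  by exists 0%N, (fun=> 0); split=> [[]|[]|[]|] //; rewrite big_ord0.
have [T0 [l [l_gt0 T0_iso rhoT0 MT0]]] := isometric_intertwiner_exists rho_like rho0.
have [rho_herm _] := like_psd rho_like.
have rk := rank_peel rho_herm l_gt0 T0_iso rhoT0.
have [k [T [T_orth MT T_ran T_sum]]] :=
  IH _ (leq_trans rk rN) (P_like_peel rho_like l_gt0 T0_iso rhoT0 MT0).
have l0 : l != 0 by rewrite gt_eqF.
have r'T : (rho - l *: (T0 *m adj T0)) *m T0 = 0.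
  by rewrite mulmxBl rhoT0 -scalemxAl -mulmxA T0_iso mulmx1 subrr.
have T_T0 s : adj (T s) *m T0 = 0.
  have [Y ->] := T_ran s; rewrite adjmxM -mulmxA.
  have [[-> _] _ _ _ _] := P_like_peel rho_like l_gt0 T0_iso rhoT0 MT0.
  by rewrite r'T mulmx0.
have T0_T s : adj T0 *m T s = 0.
  by have := congr1 (@adj R _ _) (T_T0 s); rewrite adjmxM adjmxK adjmx0.
exists k.+1, (fun s => if unlift ord0 s is Some s' then T s' else T0); split.
- move=> s t; case: (unliftP ord0 s) => [s' ->|->]; case: (unliftP ord0 t) => [t' ->|->];
  rewrite ?(inj_eq lift_inj) ?T_orth ?T_T0 ?T0_T ?T0_iso ?eqxx ?(negPf (neq_lift _ _)) //.
  + by rewrite eq_sym (negPf (neq_lift _ _)) raddf0.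
  + by rewrite raddf0.
- by move=> s i; case: unliftP.
- move=> s; case: unliftP => [s' _|_]; last first.
    by exists (l^-1 *: T0); rewrite -scalemxAr rhoT0 scalerA mulVf // scale1r.
  have [Y ->] := T_ran s'; exists ((1%:M - T0 *m adj T0) *m Y).
  by rewrite mulmxA mulmxBr mulmx1 mulmxA rhoT0 scalemxAl.
- rewrite big_ord_recl unlift_none; under eq_bigr => s _ do rewrite liftK.
  have Trho s : T s *m adj (T s) *m rho = T s *m adj (T s) *m (rho - l *: (T0 *m adj T0)).
    rewrite mulmxBr -scalemxAr (mulmxA _ T0) -(mulmxA (T s) _ T0) T_T0.
    by rewrite mulmx0 mul0mx scaler0 subr0.
  under eq_bigr => s _ do rewrite Trho.
  rewrite T_sum.
  have Trho0 : adj T0 *m rho = l *: adj T0.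
    have := congr1 (@adj R _ _) rhoT0; rewrite adjmxM adjmxZ rho_herm.
    by rewrite conj_Creal // gtr0_real.
  by rewrite -mulmxA Trho0 -scalemxAr addrC subrK.
Qed.

End Fixed.
End Decomposition.

(** * Kronecker products and vectors viewed as matrices *)

Section Tensors.
Variable R : realType.
Local Notation C := R[i].

Lemma sum_mxtens (V : nmodType) m n (F : 'I_(m * n) -> V) :
  \sum_p F p = \sum_i \sum_j F (mxtens_index (i, j)).
Proof.
rewrite pair_bigA /= (reindex (@mxtens_index m n)) /=.
  by apply: eq_bigr => -[i j] _.
by exists (@mxtens_unindex m n) => p _; rewrite ?mxtens_indexK ?mxtens_unindexK.
Qed.

Lemma mxtrace_tens m n (A : 'M[C]_m) (B : 'M[C]_n) : \tr (A *t B) = \tr A * \tr B.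
Proof.
rewrite /mxtrace sum_mxtens big_distrl /=; apply: eq_bigr => i _.
by rewrite big_distrr; apply: eq_bigr => j _; rewrite tensmxE.
Qed.

Lemma tensmx1E m n p (A : 'M[C]_(m, n)) k (X : 'M[C]_(n * k, p)) i s j :
  ((A *t 1%:M) *m X) (mxtens_index (i, s)) j =
  \sum_l A i l * X (mxtens_index (l, s)) j.
Proof.
rewrite mxE sum_mxtens; apply: eq_bigr => l _.
rewrite (bigD1 s) //= big1 ?addr0 => [|t ts].
  by rewrite tensmxE mxE eqxx mulr1.
by rewrite tensmxE mxE eq_sym (negPf ts) mulr0 mul0r.
Qed.

Lemma mul_tensmx1E m n p (A : 'M[C]_(m, n)) k (X : 'M[C]_(p, m * k)) i j s :
  (X *m (A *t 1%:M)) i (mxtens_index (j, s)) =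
  \sum_l X i (mxtens_index (l, s)) * A l j.
Proof.
rewrite mxE sum_mxtens; apply: eq_bigr => l _.
rewrite (bigD1 s) //= big1 ?addr0 => [|t ts].
  by rewrite tensmxE mxE eqxx mulr1.
by rewrite tensmxE mxE (negPf ts) mulr0 mulr0.
Qed.

Lemma psd_tens1 m k (A : 'M[C]_m) : psd A -> psd (A *t (1%:M : 'M[C]_k)).
Proof.
move=> /psd_factor [B ->].
have -> : (adj B *m B) *t (1%:M : 'M[C]_k) = adj (B *t (1%:M : 'M[C]_k)) *m (B *t 1%:M).
  by rewrite adj_tens adjmx1 tensmx_mul mulmx1.
exact: psd_adjM.
Qed.

(** For fixed ancilla indices [s], [t], the corresponding [n] by [n] block of [X] commutes with
    every [P i], so it is a scalar by Schur's lemma. These scalars are the entries of [Y]. *)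
Lemma tens_commutant n k l (P : 'I_4 -> 'M[C]_n) (X : 'M[C]_(n * k, n * l)) :
  (forall X : 'M[C]_n, (forall i, X *m P i = P i *m X) -> exists c : C, X = c%:M) ->
  (forall i, (P i *t 1%:M) *m X = X *m (P i *t 1%:M)) ->
  exists Y : 'M[C]_(k, l), X = 1%:M *t Y.
Proof.
move=> schur PX.
(* The witness reads each scalar off the entry at [ord0], which exists only for positive
   dimension. *)
case: n => [|n] in P X schur PX *.
  by exists 0; apply/matrixP=> -[].
exists (\matrix_(s, t) X (mxtens_index (ord0, s)) (mxtens_index (ord0, t))).
apply/matrixP=> p q; case: (mxtens_indexP p) (mxtens_indexP q) => i s [j t].
pose B := \matrix_(i', j') X (mxtens_index (i', s)) (mxtens_index (j', t)).
have [c Bc] : exists c : C, B = c%:M.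
  apply: schur => z; apply/matrixP=> i' j'.
  have := congr1 (fun M : 'M_(_, _) => M (mxtens_index (i', s)) (mxtens_index (j', t))) (PX z).
  rewrite tensmx1E mul_tensmx1E !mxE => h.
  transitivity (\sum_l0 X (mxtens_index (i', s)) (mxtens_index (l0, t)) * P z l0 j').
    by apply: eq_bigr => l0 _; rewrite mxE.
  by rewrite -h; apply: eq_bigr => l0 _; rewrite mxE.
have BE i' j' : X (mxtens_index (i', s)) (mxtens_index (j', t)) = (c%:M : 'M_n.+1) i' j'.
  by rewrite -Bc mxE.
by rewrite tensmxE !mxE !BE !mxE eqxx mulr1n mulr_natl.
Qed.

Definition unvec m n (w : 'cV[C]_(m * n)) : 'M[C]_(m, n) :=
  \matrix_(i, j) w (mxtens_index (i, j)) 0.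

Lemma unvec_inj m n : injective (@unvec m n).
Proof.
move=> v w vw; apply/matrixP=> p o; rewrite ord1; case: (mxtens_indexP p) => i j.
by have := congr1 (fun M : 'M_(_, _) => M i j) vw; rewrite !mxE.
Qed.

Lemma unvec_surj m n (A : 'M[C]_(m, n)) : exists w, unvec w = A.
Proof.
exists (\col_p A (mxtens_unindex p).1 (mxtens_unindex p).2).
by apply/matrixP=> i j; rewrite !mxE mxtens_indexK.
Qed.

Lemma unvec_tensmul m n p q (A : 'M[C]_(p, m)) (B : 'M[C]_(q, n)) w :
  unvec ((A *t B) *m w) = A *m unvec w *m B^T.
Proof.
apply/matrixP=> i j; rewrite !mxE sum_mxtens exchange_big /=; apply: eq_bigr => l _.
rewrite !mxE mulr_suml; apply: eq_bigr => k _.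
by rewrite tensmxE mxE mulrAC.
Qed.

Lemma unvec_dot m n (v w : 'cV[C]_(m * n)) :
  (adj v *m w) 0 0 = \tr (adj (unvec v) *m unvec w).
Proof.
rewrite mxE sum_mxtens exchange_big /=; apply: eq_bigr => j _.
by rewrite mxE; apply: eq_bigr => i _; rewrite !mxE.
Qed.

Lemma unvec_unit m n (w : 'cV[C]_(m * n)) :
  unit_vector w <-> \tr (adj (unvec w) *m unvec w) = 1.
Proof.
rewrite -unvec_dot; split; first by rewrite /unit_vector => ->; rewrite mxE.
by move=> w1; apply/matrixP=> i j; rewrite !ord1 w1 mxE.
Qed.

Lemma unvec_swap_mid m n k l (w : 'cV[C]_(m * n)) (x : 'cV[C]_(k * l)) :
  unvec (swap_mid (w *t x)) = unvec w *t unvec x.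
Proof.
apply/matrixP=> p q; case: (mxtens_indexP p) (mxtens_indexP q) => i s [j t].
rewrite tensmxE [LHS]mxE [LHS]mxE !mxtens_indexK [LHS]mxE !mxtens_indexK !mxE /=.
by congr (w _ _ * x _ _); apply: ord1.
Qed.

Lemma unvec_phi n : unvec (@phi R n) = ((real_complex R (Num.sqrt n%:R))^-1)%:M.
Proof.
apply/matrixP=> i j; rewrite !mxE mxtens_indexK fmorphV.
by case: (i == j).
Qed.

End Tensors.

(** * Local isometries assembled from the copies of [P] *)

Section LocalIsometry.
Variable R : realType.
Local Notation C := R[i].

(** The first [k] ancilla levels of [U] carry the maps [adj (T s)]. The complement [Q] of their
    ranges is sent to the first basis vector of dimension [n] tensored with [m] further levels,
    which makes [U] an isometry. Matrices with columns in the span of the ranges have no component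
    there, so the intertwining relation can be checked level by level. *)
Lemma gather_isometries n m k (T : 'I_k -> 'M[C]_(m, n)) :
  (0 < n)%N -> (forall s t, adj (T s) *m T t = (s == t)%:R%:M) ->
  exists U : 'M[C]_(n * (k + m), m), isometry U /\
    forall q (A : 'M[C]_n) (X Y : 'M[C]_(m, q)),
      (forall s, adj (T s) *m X = A *m (adj (T s) *m Y)) ->
      \sum_s T s *m adj (T s) *m X = X -> \sum_s T s *m adj (T s) *m Y = Y ->
      U *m X = (A *t 1%:M) *m (U *m Y).
Proof.
case: n T => // n T _ T_orth.
pose Pi := \sum_s T s *m adj (T s).
have Pi_herm : adj Pi = Pi.
  rewrite /Pi; elim/big_rec: _ => [|s A _ hA]; first exact: adjmx0.
  by rewrite adjmxD hA adjmxM adjmxK.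
have Pi_idem : Pi *m Pi = Pi.
  rewrite {2}/Pi mulmx_sumr; apply: eq_bigr => s _.
  rewrite mulmxA /Pi mulmx_suml (bigD1 s) //= big1 ?addr0 => [|t ts].
    by rewrite -(mulmxA (T s)) T_orth eqxx mulmx1.
  by rewrite -(mulmxA (T t)) T_orth (negPf ts) raddf0 mulmx0.
pose Q := 1%:M - Pi.
have QQ : adj Q *m Q = Q.
  rewrite /Q adjmxB adjmx1 Pi_herm mulmxBr mulmx1 mulmxBl mul1mx Pi_idem.
  by rewrite subrr subr0.
pose U : 'M[C]_(n.+1 * (k + m), m) := \matrix_(p, x)
  match split (mxtens_unindex p).2 with
  | inl s => adj (T s) (mxtens_unindex p).1 x
  | inr t => ((mxtens_unindex p).1 == ord0)%:R * Q t x
  end.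
have UE j s x : U (mxtens_index (j, s)) x =
    match split s with inl s => adj (T s) j x | inr t => (j == ord0)%:R * Q t x end.
  by rewrite mxE mxtens_indexK.
have Ul j s x : U (mxtens_index (j, lshift m s)) x = adj (T s) j x.
  by rewrite UE -[lshift m s]/(unsplit (inl s)) unsplitK.
have Ur j t x : U (mxtens_index (j, rshift k t)) x = (j == ord0)%:R * Q t x.
  by rewrite UE -[rshift k t]/(unsplit (inr t)) unsplitK.
have UM q (X : 'M[C]_(m, q)) j s x : (U *m X) (mxtens_index (j, s)) x =
    match split s with
    | inl s => (adj (T s) *m X) j x
    | inr t => (j == ord0)%:R * (Q *m X) t x end.
  rewrite mxE; under eq_bigr => y _ do rewrite UE.
  case: split => [s'|t]; rewrite mxE // mulr_sumr.
  by apply: eq_bigr => y _; rewrite mulrA.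
exists U; split.
  have PQ : Pi + Q = 1%:M by rewrite addrC subrK.
  rewrite /isometry -PQ.
  apply/matrixP=> x y; rewrite mxE sum_mxtens.
  under eq_bigr => j _ do rewrite big_split_ord /=.
  rewrite big_split /= [RHS]mxE; congr (_ + _).
    rewrite exchange_big summxE; apply: eq_bigr => s _; rewrite mxE.
    by apply: eq_bigr => j _; rewrite adjmxE !Ul (adjmxE _ _ x) conjCK.
  rewrite -QQ big_ord_recl [X in _ + X]big1 ?addr0 => [|j _]; last first.
    by apply: big1 => t _; rewrite adjmxE !Ur !mul0r mulr0.
  by rewrite mxE; apply: eq_bigr => t _; rewrite !adjmxE !Ur !mul1r.
move=> q A X Y TX PX PY.
have QX : Q *m X = 0 by rewrite mulmxBl mul1mx mulmx_suml PX subrr.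
have QY : Q *m Y = 0 by rewrite mulmxBl mul1mx mulmx_suml PY subrr.
apply/matrixP=> p x; case: (mxtens_indexP p) => j s.
rewrite tensmx1E UM; under eq_bigr => l _ do rewrite UM.
case: split => [s'|t]; first by rewrite TX mxE.
by rewrite QX QY mxE mulr0 big1 // => l _; rewrite ?mxE !mulr0.
Qed.

Variables (n : nat) (P : 'I_4 -> 'M[C]_n) (a f e : C).
Hypothesis P_herm : forall i, hermitian (P i).
Hypothesis P_idem : forall i, P i *m P i = P i.
Hypothesis P_sum : \sum_i P i = a *: 1%:M.
Hypothesis n_gt0 : (0 < n)%N.
Hypothesis a_def : a = 2 - n%:R^-1.
Hypothesis e_sqr : e ^+ 2 = 1.
Hypothesis P_tr : forall i, \tr (P i) = f - e * (i == ord0)%:R.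
Hypothesis P_schur : forall X : 'M[C]_n, (forall i, X *m P i = P i *m X) ->
  exists c : C, X = c%:M.

Lemma mulmx_gram_eq0 p q r (X : 'M[C]_(p, q)) (Y : 'M[C]_(q, r)) :
  X *m (Y *m adj Y) = 0 -> X *m Y = 0.
Proof.
move=> XY; have : adj (X *m Y) = 0.
  apply: mxtrace_adjM_eq0.
  by rewrite adjmxK adjmxM mulmxA -(mulmxA X) XY mul0mx mxtrace0.
by move/(congr1 (@adj R _ _)); rewrite adjmxK adjmx0.
Qed.

(** The reduced state [Psi *m adj Psi] is [P_like]; its commutation with [A i] comes from moving
    [A i] across [Psi] and taking adjoints. The isometries of its decomposition are then gathered
    into [U]. *)
Lemma local_isometry p q (A : 'I_4 -> 'M[C]_p) (B : 'I_4 -> 'M[C]_q) (Psi : 'M[C]_(p, q)) :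
  (forall i, hermitian (A i)) -> (forall i, hermitian (B i)) ->
  (forall i, A i *m Psi = Psi *m (B i)^T) ->
  (forall i, A i *m (A i *m Psi) = A i *m Psi) ->
  \sum_i A i *m Psi = a *: Psi ->
  \tr (adj Psi *m (A ord0 *m Psi)) = (f - e) / n%:R * \tr (adj Psi *m Psi) ->
  exists (k : nat) (U : 'M[C]_(n * k, p)), isometry U /\
    forall i, U *m (A i *m Psi) = (P i *t 1%:M) *m (U *m Psi).
Proof.
move=> A_herm B_herm AB A_idem A_sum A_tr.
have rho_like : P_like n a f e A (Psi *m adj Psi).
  split.
  - by rewrite -{1}(adjmxK Psi); apply: psd_adjM.
  - move=> i; have := congr1 (@adj R _ _) (AB i).
    rewrite !adjmxM A_herm adj_trmx B_herm => h.
    by rewrite mulmxA AB -!mulmxA h.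
  - by move=> i; rewrite !mulmxA -(mulmxA (A i)) A_idem.
  - under eq_bigr => i _ do rewrite mulmxA.
    by rewrite -mulmx_suml A_sum scalemxAl.
  - by rewrite mulmxA mxtrace_mulC A_tr [in RHS]mxtrace_mulC.
have [k [T [T_orth AT _ T_sum]]] := isotypic_decomposition P_herm P_idem P_sum
  n_gt0 a_def e_sqr P_tr P_schur A_herm rho_like.
have [U [U_iso UE]] := gather_isometries n_gt0 T_orth.
exists (k + p)%N, U; split=> // i.
have TA s : adj (T s) *m A i = P i *m adj (T s).
  by have := congr1 (@adj R _ _) (AT s i); rewrite !adjmxM A_herm P_herm.
(* The decomposition covers the range of [Psi *m adj Psi], which is the range of [Psi]. *)
have T_Psi : \sum_s T s *m adj (T s) *m Psi = Psi.
  apply/eqP; rewrite -mulmx_suml -subr_eq0 -[X in _ - X]mul1mx -mulmxBl; apply/eqP.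
  by apply: mulmx_gram_eq0; rewrite mulmxBl mul1mx mulmx_suml T_sum subrr.
apply: UE => //; first by move=> s; rewrite mulmxA TA mulmxA.
rewrite -[in RHS]T_Psi mulmx_sumr; apply: eq_bigr => s _.
by rewrite !mulmxA AT -!mulmxA (mulmxA (adj _)) TA !mulmxA.
Qed.

End LocalIsometry.

(** * Integrality of the spectrum of [n (P_3 + P_4)] *)

Section Spectrum.
Variable R : realType.
Local Notation C := R[i].

Lemma mxtrace_adjM_gt0 m n (v : 'M[C]_(m, n)) : v != 0 -> 0 < \tr (adj v *m v).
Proof.
move=> v0; rewrite lt0r mxtrace_adjM_ge0 andbT.
by apply: contra v0 => /eqP /mxtrace_adjM_eq0 ->.
Qed.

Lemma projection_tr_ge0 n (P : 'M[C]_n) (v : 'cV[C]_n) :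
  hermitian P -> P *m P = P -> 0 <= \tr (adj v *m (P *m v)).
Proof.
move=> hP PP; rewrite -PP -mulmxA mulmxA -{1}hP -adjmxM; exact: mxtrace_adjM_ge0.
Qed.

Lemma projection_compl n (P : 'M[C]_n) :
  P *m P = P -> (1%:M - P) *m (1%:M - P) = 1%:M - P.
Proof. by move=> PP; rewrite mulmxBl mul1mx mulmxBr mulmx1 PP subrr subr0. Qed.

(* [P - Q] anticommutes with [P + Q - 1] and [(P - Q)^2 = 2 (P + Q) - (P + Q)^2]. *)
Lemma projection_pair_eigen n (P Q : 'M[C]_n) (v : 'cV[C]_n) (b : C) :
  hermitian P -> P *m P = P -> hermitian Q -> Q *m Q = Q ->
  v != 0 -> (P + Q) *m v = b *: v ->
  [/\ 0 <= b, b <= 2 & b = 0 \/ b = 2 \/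
   exists2 w : 'cV[C]_n, w != 0 & w = (P - Q) *m v /\ (P + Q) *m w = (2 - b) *: w].
Proof.
move=> hP PP hQ QQ v0 ev.
have v_gt0 := mxtrace_adjM_gt0 v0.
have b_ge0 : 0 <= b.
  rewrite -(pmulr_lge0 b v_gt0) -mxtraceZ scalemxAr -ev mulmxDl mulmxDr raddfD /=.
  by rewrite addr_ge0 ?projection_tr_ge0.
have b_le2 : b <= 2.
  rewrite -subr_ge0 -(pmulr_lge0 _ v_gt0) -mxtraceZ scalemxAr scalerBl -ev.
  have -> : 2 *: v - (P + Q) *m v = (1%:M - P) *m v + (1%:M - Q) *m v.
    by rewrite !mulmxBl mul1mx mulmxDl scaler_nat mulr2n opprD addrACA.
  rewrite mulmxDr raddfD /= addr_ge0 ?projection_tr_ge0 ?projection_compl //;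
    by rewrite /hermitian adjmxB adjmx1 ?hP ?hQ.
split=> //.
have anti : (P + Q) *m (P - Q) = 2 *: (P - Q) - (P - Q) *m (P + Q).
  rewrite !mulmxDl !mulmxDr !mulNmx !mulmxN PP QQ scaler_nat mulr2n.
  apply/matrixP=> i j; rewrite !mxE; ring.
have sqr : (P - Q) *m (P - Q) = 2 *: (P + Q) - (P + Q) *m (P + Q).
  rewrite !mulmxDl !mulmxDr !mulNmx !mulmxN PP QQ scaler_nat mulr2n.
  apply/matrixP=> i j; rewrite !mxE; ring.
(* A nonzero [(P - Q) *m v] is the flipped eigenvector; if it vanishes, [sqr] applied to [v] gives
   [b (2 - b) = 0]. *)
have [w0|w0] := eqVneq ((P - Q) *m v) 0; last first.
  right; right; exists ((P - Q) *m v) => //; split=> //.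
  by rewrite mulmxA anti mulmxBl -mulmxA ev -scalemxAl -scalemxAr -scalerBl.
have : (b * (2 - b)) *: v = 0.
  have := congr1 (fun x => x *m v) sqr; rewrite -mulmxA w0 mulmx0 mulmxBl -mulmxA ev.
  rewrite -scalemxAl -scalemxAr ev !scalerA -scalerBl => ->.
  by congr (_ *: _); ring.
move/eqP; rewrite scaler_eq0 (negPf v0) orbF mulf_eq0 subr_eq0.
by case/orP => /eqP; [left|right; left].
Qed.

Variables (n : nat) (P : 'I_4 -> 'M[C]_n).
Hypothesis P_herm : forall i, hermitian (P i).
Hypothesis P_idem : forall i, P i *m P i = P i.
Hypothesis P_sum : \sum_i P i = (2 - n%:R^-1) *: 1%:M.
Hypothesis n_gt0 : (0 < n)%N.

(* The flips [b |-> 2 - b] of [P i2 + P i3] and of [P i0 + P i1 = 2 - 1/n - b]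
   compose to [b |-> b - 2/n], which must end at [b = 0] or [b = 1/n]. *)
Lemma pair_sum_eigenvalue (v : 'cV[C]_n) (b : C) :
  v != 0 -> (P (inord 2) + P (inord 3)) *m v = b *: v -> exists k, n%:R * b = k%:R.
Proof.
have n0 : n%:R != 0 :> C by rewrite pnatr_eq0 -lt0n.
have V_gt0 : 0 < n%:R^-1 :> C by rewrite invr_gt0 ltr0n.
have other : P (inord 0) + P (inord 1) = (2 - n%:R^-1) *: 1%:M - (P (inord 2) + P (inord 3)).
  rewrite -P_sum !big_ord_recl big_ord0.
  have inordE (k : nat) (j : 'I_4) : k = val j -> inord k = j by move=> ->; apply: inord_val.
  rewrite (inordE 0%N ord0) // (inordE 1%N (@lift 4 ord0 (@ord0 2))) //.
  rewrite (inordE 2%N (@lift 4 ord0 (@lift 3 ord0 (@ord0 1)))) //.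
  rewrite (inordE 3%N (@lift 4 ord0 (@lift 3 ord0 (@lift 2 ord0 (@ord0 0))))) //.
  by rewrite addr0 addrA addrK.
have flip (x : 'cV[C]_n) c : (P (inord 2) + P (inord 3)) *m x = c *: x <->
    (P (inord 0) + P (inord 1)) *m x = (2 - n%:R^-1 - c) *: x.
  rewrite other mulmxBl -scalemxAl mul1mx (scalerBl _ c); split=> [->//|].
  by move/(congr1 (fun y => (2 - n%:R^-1) *: x - y)); rewrite !subKr.
have pair i j := fun x c => @projection_pair_eigen n (P i) (P j) x c
  (P_herm i) (P_idem i) (P_herm j) (P_idem j).
(* [N] exceeds [2 * n], hence also [n%:R * b] since [b <= 2]. A double flip lowers [n%:R * b] by 2,
   more than the induction on [N] requires. *)
have [N] := ubnP (2 * n)%N; move=> bN v0 ev.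
have : n%:R * b < N%:R.
  have [_ b2 _] := pair _ _ _ _ v0 ev.
  apply: le_lt_trans (_ : n%:R * 2 < _); first by rewrite ler_pM2l ?ltr0n.
  by rewrite -natrM ltr_nat mulnC.
elim: N {bN} v b v0 ev => [|N IH] v b v0 ev bN.
  have [b0 _ _] := pair _ _ _ _ v0 ev.
  by have := le_lt_trans (mulr_ge0 (ler0n _ n) b0) bN; rewrite ltxx.
have [b0 b2 [->|[b_eq|[w w0 [_ ew]]]]] := pair _ _ _ _ v0 ev.
- by exists 0%N; rewrite mulr0.
(* For [b = 2] the complementary pair would have the negative eigenvalue [- 1/n]. *)
- have /(pair _ _ _ _ v0) [+ _ _] := (flip v b).1 ev.
  by rewrite b_eq addrAC subrr sub0r oppr_ge0 (lt_geF V_gt0).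
(* On [w] the complementary pair has eigenvalue [b - 1/n]: the value [0] means [b = 1/n], and the
   value [2] would give [b > 2]. *)
have [_ c2 [c0|[c_eq|[u u0 [_ eu]]]]] := pair _ _ _ _ w0 ((flip _ _).1 ew).
- exists 1%N; have -> : b = n%:R^-1 + 0 by rewrite -c0; ring.
  by rewrite addr0 mulfV.
- have : b = 2 + n%:R^-1 by rewrite -[in RHS]c_eq; ring.
  by move=> b_eq; move: b2; rewrite b_eq gerDl (lt_geF V_gt0).
have /IH : (P (inord 2) + P (inord 3)) *m u = (b - 2 * n%:R^-1) *: u.
  by apply/flip; rewrite eu; congr (_ *: _); ring.
have nb : n%:R * (b - 2 * n%:R^-1) = n%:R * b - 2 by rewrite mulrBr mulrCA mulfV // mulr1.
rewrite nb => /(_ u0) [|k kE]; last by exists k.+2; rewrite -addn2 natrD -kE subrK.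
rewrite ltrBlDr (lt_le_trans bN) // -natrD ler_nat; lia.
Qed.

(** A kernel vector would be an eigenvector of [n (P_3 + P_4)] for [2 r - 1/2], which is not an
    integer. *)
Lemma sgn_argument_unit (r : nat) :
  (2 * r%:R - 2^-1) *: 1%:M - n%:R *: (P (inord 2) + P (inord 3)) \in unitmx.
Proof.
set H := _ - _; rewrite -row_free_unit -kermx_eq0; apply/negPn/negP => K0.
have n0 : n%:R != 0 :> C by rewrite pnatr_eq0 -lt0n.
have /rowV0Pn [x /sub_kermxP xH x0] := K0.
have H_herm : adj H = H.
  rewrite /H adjmxB !adjmxZ adjmx1 adjmxD !P_herm conjC_nat.
  by rewrite conj_Creal // realB ?realM ?realn ?realV.
have Hv : H *m adj x = 0.
  by have := congr1 (@adj R _ _) xH; rewrite adjmxM H_herm adjmx0.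
have v0 : adj x != 0.
  by apply: contra x0 => /eqP /(congr1 (@adj R _ _)); rewrite adjmxK adjmx0 => ->.
have [|k] := pair_sum_eigenvalue (b := n%:R^-1 * (2 * r%:R - 2^-1)) v0.
  apply: (scalerI n0); rewrite scalerA mulVKf //.
  move: Hv; rewrite /H mulmxBl -!scalemxAl mul1mx => /eqP.
  by rewrite subr_eq0 => /eqP ->.
rewrite mulVKf // => h.
have : (4 * r)%:R = (2 * k + 1)%:R :> C.
  by rewrite natrD !natrM -h; field.
move/eqP; rewrite eqr_nat; lia.
Qed.

End Spectrum.

(** * The matrix sign and its spectral projection *)

Section Sign.
Variable R : realType.
Local Notation C := R[i].

Lemma psd_unit_pd n (A : 'M[C]_n) : psd A -> A \in unitmx -> pd A.
Proof.
move=> /[dup] -[A_herm _] /psd_factor [B eA] uA; split=> // v v0.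
rewrite -mxtrace11 eA mulmxA -adjmxM -mulmxA mxtrace_adjM_gt0 //.
apply: contra v0 => /eqP Bv; apply/eqP.
by rewrite -(mulKmx uA v) eA -mulmxA Bv !mulmx0.
Qed.

(** In an eigenbasis of [H] the witness has diagonal [D / |D|]. Its product with [H] has diagonal
    [|D|], so it is positive semidefinite and invertible. *)
Lemma sgn_spec_sgn n (H : 'M[C]_n) : hermitian H -> H \in unitmx -> sgn_spec H (sgn H).
Proof.
move=> H_herm H_unit; apply: epsilon_spec.
have [U [D [UU UU' eH]]] := hermitian_spectral H_herm.
have D_eq : diag_mx D = U *m H *m adj U.
  by rewrite eH !mulmxA UU mul1mx -mulmxA UU mulmx1.
have D_real i : (D 0 i)^* = D 0 i.
  have : adj (diag_mx D) = diag_mx D by rewrite D_eq !adjmxM adjmxK H_herm mulmxA.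
  by rewrite adj_diag => /matrixP /(_ i i); rewrite !mxE eqxx !mulr1n.
have D0 i : D 0 i != 0.
  have : diag_mx D \in unitmx.
    rewrite D_eq !unitmx_mul H_unit andbT.
    by have [-> ->] := mulmx1_unit UU.
  by rewrite unitmxE det_diag unitfE => /prodf_neq0 ->.
have mulE (F G : 'rV[C]_n) := mulmx_conj_diag F G UU.
pose s : 'rV[C]_n := \row_i (D 0 i / `|D 0 i|).
pose S := adj U *m diag_mx s *m U.
have S_herm : adj S = S.
  rewrite /S !adjmxM adjmxK adj_diag mulmxA; congr (_ *m diag_mx _ *m _).
  apply/rowP=> i; rewrite !mxE rmorphM fmorphV /= D_real.
  by rewrite (conj_Creal (normr_real _)).
have SS : S *m S = 1%:M.
  rewrite /S mulE -[RHS]UU' -[X in _ = X *m _]mulmx1 -diag_const_mx.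
  congr (_ *m diag_mx _ *m _); apply/rowP=> i; rewrite !mxE.
  rewrite mulrACA -invfM -expr2 -[X in _ / X]expr2 -{1}(ger0_norm (x := D 0 i ^+ 2)).
    by rewrite normrX mulfV // expf_neq0 // normr_eq0.
  by rewrite real_exprn_even_ge0 //; apply/CrealP.
exists S; split=> //; first by rewrite S_herm.
  rewrite eH /S !mulE; congr (_ *m diag_mx _ *m _).
  by apply/rowP=> i; rewrite !mxE mulrC.
apply: psd_unit_pd; last by rewrite unitmx_mul H_unit andbT; have [] := mulmx1_unit SS.
have -> : S *m H = adj (diag_mx (\row_i sqrtC `|D 0 i|) *m U) *m
                   (diag_mx (\row_i sqrtC `|D 0 i|) *m U).
  rewrite adjmxM adj_diag {1}eH /S mulE !mulmxA -(mulmxA (adj U) (diag_mx _) (diag_mx _)).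
  rewrite mulmx_diag; congr (_ *m diag_mx _ *m _); apply/rowP=> i; rewrite !mxE.
  rewrite conj_Creal ?ger0_real ?sqrtC_ge0 // -expr2 sqrtCK mulrAC -expr2.
  rewrite -[X in X / _]ger0_norm; last by rewrite real_exprn_even_ge0 //; apply/CrealP.
  by rewrite normrX expr2 mulfK // normr_eq0.
exact: psd_adjM.
Qed.

Lemma psd_conj m n (A : 'M[C]_n) (X : 'M[C]_(n, m)) : psd A -> psd (adj X *m A *m X).
Proof.
move=> /psd_factor [B ->].
by rewrite mulmxA -adjmxM -mulmxA; apply: psd_adjM.
Qed.

(** Splits [H] into its positive part [Q *m H] and negative part [Q *m H - H]. Since [Q *m S = Q]
    and [(1 - Q) *m S = - (1 - Q)], these are the compressions of [S *m H] by [Q] and by [1 - Q]. *)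
Lemma sgn_projection_split n (H S Q : 'M[C]_n) :
  sgn_spec H S -> Q = 2^-1 *: (1%:M + S) ->
  [/\ psd (Q *m H), psd (Q *m H - H) & Q *m H = H *m Q].
Proof.
move=> [S_herm SS SH [SH_herm SH_pos]] QE; rewrite S_herm in SS.
have Q_herm : adj Q = Q.
  rewrite QE adjmxZ adjmxD adjmx1 S_herm.
  by rewrite conj_Creal // rpredV realn.
have QS : Q *m S = Q by rewrite QE -scalemxAl mulmxDl mul1mx SS addrC.
have QQ : Q *m Q = Q.
  rewrite {2}QE -scalemxAr mulmxDr mulmx1 QS scalerDr -scalerDl.
  by rewrite (_ : 2^-1 + 2^-1 = 1) ?scale1r //; field.
have QH : Q *m H = H *m Q.
  by rewrite QE -scalemxAl -scalemxAr mulmxDl mulmxDr mul1mx mulmx1 SH.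
have SH_psd : psd (S *m H).
  split=> // v; have [->|v0] := eqVneq v 0; last exact/ltW/SH_pos.
  by rewrite mulmx0 mxE.
split; [| |exact: QH].
  have := psd_conj Q SH_psd.
  by rewrite Q_herm mulmxA QS -mulmxA -QH mulmxA QQ.
have := psd_conj (1%:M - Q) SH_psd.
rewrite adjmxB adjmx1 Q_herm mulmxA mulmxBl mul1mx QS.
have SQ : S - Q = Q - 1%:M.
  by apply/matrixP=> i j; rewrite QE !mxE; field.
by rewrite SQ -mulmxA mulmxBl mul1mx !mulmxBr mulmx1 -QH (mulmxA Q Q) QQ subrr sub0r opprB.
Qed.

End Sign.

(** * From the correlation to operator identities on the state *)

Section Rigidity.
Variable R : realType.
Local Notation C := R[i].

Lemma tensmxBl m n p q (A B : 'M[C]_(m, n)) (X : 'M[C]_(p, q)) :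
  (A - B) *t X = A *t X - B *t X.
Proof. by apply/matrixP=> i j; rewrite !mxE mulrBl. Qed.

Lemma tensmxDl m n p q (A B : 'M[C]_(m, n)) (X : 'M[C]_(p, q)) :
  (A + B) *t X = A *t X + B *t X.
Proof. by apply/matrixP=> i j; rewrite !mxE mulrDl. Qed.

Lemma tensmxZl m n p q c (A : 'M[C]_(m, n)) (X : 'M[C]_(p, q)) :
  (c *: A) *t X = c *: (A *t X).
Proof. by apply/matrixP=> i j; rewrite !mxE mulrA. Qed.

Lemma tensmx11 m n : (1%:M : 'M[C]_m) *t (1%:M : 'M[C]_n) = 1%:M.
Proof.
apply/matrixP=> p q; case: (mxtens_indexP p) (mxtens_indexP q) => i s [j t].
rewrite tensmxE !mxE (can_eq (@mxtens_indexK m n)) xpair_eqE.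
by rewrite -natrM mulnb.
Qed.

Lemma psd_add n (A B : 'M[C]_n) : psd A -> psd B -> psd (A + B).
Proof.
move=> [hA pA] [hB pB]; split; first by rewrite /hermitian adjmxD hA hB.
by move=> v; rewrite mulmxDr mulmxDl mxE addr_ge0.
Qed.

Variables (n : nat) (P : 'I_4 -> 'M[C]_n) (f e : C).
Let a : C := 2 - n%:R^-1.
Hypothesis P_herm : forall i, hermitian (P i).
Hypothesis P_tr_sym : forall i, (P i)^T = P i.
Hypothesis P_idem : forall i, P i *m P i = P i.
Hypothesis P_sum : \sum_i P i = a *: 1%:M.
Hypothesis n_gt0 : (0 < n)%N.
Hypothesis e_sqr : e ^+ 2 = 1.
Hypothesis P_tr : forall i, \tr (P i) = f - e * (i == ord0)%:R.
Hypothesis P_schur : forall X : 'M[C]_n, (forall i, X *m P i = P i *m X) ->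
  exists c : C, X = c%:M.

Variables (p q : nat) (Psi : 'M[C]_(p, q)).
Hypothesis Psi_unit : \tr (adj Psi *m Psi) = 1.

Section Projections.
Variables (A : 'I_4 -> 'M[C]_p) (B : 'I_4 -> 'M[C]_q).
Hypothesis A_psd : forall i, psd (A i) /\ psd (1%:M - A i).
Hypothesis B_psd : forall i, psd (B i) /\ psd (1%:M - B i).
Hypothesis corr : forall i j,
  \tr (adj Psi *m (A i *m Psi *m (B j)^T)) = n%:R^-1 * \tr (P i *m P j).
Hypothesis corrA : forall i, \tr (adj Psi *m (A i *m Psi)) = n%:R^-1 * \tr (P i).
Hypothesis corrB : forall i, \tr (adj Psi *m (Psi *m (B i)^T)) = n%:R^-1 * \tr (P i).

Let n0 : n%:R != 0 :> C. Proof. by rewrite pnatr_eq0 -lt0n. Qed.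

(** On equal inputs unequal outcomes have probability zero, because [P i] is idempotent. Hence both
    sides equal [A i *m Psi *m (B i)^T]. *)
Lemma corr_transfer i : A i *m Psi = Psi *m (B i)^T.
Proof.
have [A1 A2] := A_psd i; have [B1 B2] := B_psd i.
have [_ z1] := mxtrace_psd_sandwich Psi A1 (psd_trmx B2).
have [_ z2] := mxtrace_psd_sandwich Psi A2 (psd_trmx B1).
have e1 : A i *m Psi *m (1%:M - B i)^T = 0.
  apply: z1; rewrite linearB /= trmx1 mulmxBr mulmx1 raddfB /= -!mulmxA.
  by rewrite corrA (mulmxA (A i)) corr P_idem subrr.
have e2 : (1%:M - A i) *m Psi *m (B i)^T = 0.
  apply: z2; rewrite -!mulmxA mulmxBl mul1mx mulmxBr raddfB /=.
  by rewrite corrB (mulmxA (A i)) corr P_idem subrr.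
move/eqP: e1; rewrite linearB /= trmx1 mulmxBr mulmx1 subr_eq0 => /eqP ->.
by move/eqP: e2; rewrite !mulmxBl mul1mx subr_eq0 => /eqP ->.
Qed.

Lemma corr_idem i : A i *m (A i *m Psi) = A i *m Psi.
Proof.
have [A1 A2] := A_psd i; have [B1 B2] := B_psd i.
have [_ z1] := mxtrace_psd_sandwich Psi A1 (psd_trmx B2).
rewrite {1}corr_transfer; apply/esym/eqP; rewrite mulmxA -subr_eq0; apply/eqP.
rewrite -[X in X - _]mulmx1 -mulmxBr -trmx1 -linearB /=; apply: z1.
rewrite linearB /= trmx1 mulmxBr mulmx1 raddfB /= -!mulmxA.
by rewrite corrA (mulmxA (A i)) corr P_idem subrr.
Qed.

(** [X = \sum_i A i] has mean [a] and second moment [a ^+ 2] in the state [Psi], so [(X - a) Psi]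
    has norm zero. The second moment is read off the correlation after one factor [X] has been moved
    to Bob. *)
Lemma corr_sum : \sum_i A i *m Psi = a *: Psi.
Proof.
pose X := \sum_i A i; pose Y := \sum_i (B i)^T.
have XPsi : X *m Psi = Psi *m Y.
  by rewrite mulmx_suml mulmx_sumr; apply: eq_bigr => i _; apply: corr_transfer.
have X_herm : adj X = X.
  rewrite /X; elim/big_rec: _ => [|i M _ hM]; first exact: adjmx0.
  by rewrite adjmxD hM; have [[-> _] _] := A_psd i.
have tr1 : \tr (adj Psi *m (X *m Psi)) = a.
  rewrite mulmx_suml mulmx_sumr raddf_sum /=.
  under eq_bigr => i _ do rewrite corrA.
  by rewrite -mulr_sumr -raddf_sum P_sum /= mxtraceZ mxtrace1 mulrCA mulVf // mulr1.
have tr2 : \tr (adj Psi *m (X *m (X *m Psi))) = a ^+ 2.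
  rewrite XPsi (mulmxA X) /X !mulmx_suml /Y.
  under eq_bigr => i _ do rewrite mulmx_sumr.
  rewrite exchange_big /= mulmx_sumr raddf_sum /=.
  under eq_bigr => j _.
    rewrite mulmx_sumr raddf_sum /=; under eq_bigr => i _ do rewrite corr.
    rewrite -mulr_sumr -raddf_sum /= -mulmx_suml P_sum.
    over.
  rewrite -mulr_sumr -raddf_sum /= -mulmx_sumr P_sum.
  by rewrite -scalemxAl mul1mx scalerA mxtraceZ mxtrace1 mulrCA mulVf // mulr1 expr2.
apply/eqP; rewrite -mulmx_suml -/X -subr_eq0; apply/eqP/mxtrace_adjM_eq0.
have a_real : a^* = a by rewrite conj_Creal // realB ?realV ?realn.
rewrite adjmxB adjmxM adjmxZ X_herm a_real.
rewrite mulmxBl !mulmxBr -!scalemxAl -!scalemxAr !raddfB /= !mxtraceZ.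
rewrite -!(mulmxA (adj Psi)) tr2 tr1 Psi_unit.
ring.
Qed.

End Projections.

Variables (A : 'I_4 -> 'M[C]_p) (B : 'I_4 -> 'M[C]_q).
Hypothesis A_psd : forall i, psd (A i) /\ psd (1%:M - A i).
Hypothesis B_psd : forall i, psd (B i) /\ psd (1%:M - B i).
Hypothesis corr : forall i j,
  \tr (adj Psi *m (A i *m Psi *m (B j)^T)) = n%:R^-1 * \tr (P i *m P j).
Hypothesis corrA : forall i, \tr (adj Psi *m (A i *m Psi)) = n%:R^-1 * \tr (P i).
Hypothesis corrB : forall i, \tr (adj Psi *m (Psi *m (B i)^T)) = n%:R^-1 * \tr (P i).

(** [local_isometry] is applied to [Psi] for Alice and to [Psi^T] for Bob; transposing back uses
    that each [P i] is symmetric. The transformed state commutes with every [P i *t 1%:M], so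
    [tens_commutant] splits off the auxiliary factor. *)
Lemma rigidity (c : C) : c * c^* = n%:R^-1 ->
  exists k l (U : 'M[C]_(n * k, p)) (V : 'M[C]_(n * l, q)) (Aux : 'M[C]_(k, l)),
  [/\ isometry U, isometry V & \tr (adj Aux *m Aux) = 1] /\
  [/\ U *m Psi *m V^T = c *: (1%:M *t Aux),
      forall i, U *m (A i *m Psi) *m V^T = (P i *t 1%:M) *m (U *m Psi *m V^T) &
      forall j, Psi *m (B j)^T *m V^T = Psi *m V^T *m (P j *t 1%:M)].
Proof.
move=> cc.
have n0 : n%:R != 0 :> C by rewrite pnatr_eq0 -lt0n.
have c0 : c != 0.
  by apply: contraNneq n0 => c0; rewrite -[n%:R]invrK -cc c0 mul0r invr0.
have A_herm i : hermitian (A i) by have [[]] := A_psd i.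
have B_herm i : hermitian (B i) by have [[]] := B_psd i.
have AB := corr_transfer A_psd B_psd corr corrA corrB.
have AA := corr_idem A_psd B_psd corr corrA corrB.
have A_sum := corr_sum A_psd B_psd corr corrA corrB.
have tr0 : \tr (P ord0) = f - e by rewrite P_tr eqxx mulr1.
have [|k [U [U_iso UA]]] := local_isometry P_herm P_idem P_sum n_gt0 erefl e_sqr
  P_tr P_schur A_herm B_herm AB AA A_sum.
  by rewrite corrA Psi_unit mulr1 tr0 mulrC.
have BPsi i : B i *m Psi^T = (A i *m Psi)^T by rewrite AB trmx_mul trmxK.
have [||||l [V [V_iso VB]]] := @local_isometry R n P a f e P_herm P_idem P_sum
  n_gt0 erefl e_sqr P_tr P_schur q p B A Psi^T B_herm A_herm _ _ _ _.
- by move=> i; rewrite BPsi trmx_mul.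
- move=> i; rewrite BPsi trmx_mul mulmxA BPsi -trmx_mul.
  by rewrite -trmx_mul AA.
- under eq_bigr => i _ do rewrite BPsi.
  by rewrite -raddf_sum A_sum /= linearZ.
- have -> : \tr (adj Psi^T *m (B ord0 *m Psi^T)) = n%:R^-1 * \tr (P ord0).
    by rewrite -corrB adj_trmx BPsi -trmx_mul mxtrace_tr AB mxtrace_mulC.
  by rewrite adj_trmx -trmx_mul mxtrace_tr mxtrace_mulC Psi_unit mulr1 tr0 mulrC.
have BV j : Psi *m (B j)^T *m V^T = Psi *m V^T *m (P j *t 1%:M).
  by have := congr1 trmx (VB j); rewrite !trmx_mul !trmxK trmx_tens P_tr_sym trmx1.
pose Phi := U *m Psi *m V^T.
have UAV i : U *m (A i *m Psi) *m V^T = (P i *t 1%:M) *m Phi.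
  by rewrite UA /Phi !mulmxA.
(* Moving [A i] across [Psi] turns left multiplication of [Phi] by [P i *t 1%:M] into right
   multiplication. *)
have [|Y Phi_eq] := tens_commutant (X := Phi) P_schur.
  by move=> i; rewrite -UAV AB mulmxA -!mulmxA (mulmxA Psi) BV !mulmxA.
(* [Phi = 1%:M *t Y] has unit norm, so [\tr (adj Y *m Y) = 1/n]; dividing by [c] normalises it. *)
exists k, l, U, V, (c^-1 *: Y); split; split=> //.
- have VV : V^T *m adj V^T = 1%:M by rewrite adj_trmx -trmx_mul V_iso trmx1.
  have : \tr (adj Phi *m Phi) = 1.
    rewrite -Psi_unit /Phi !adjmxM mulmxA mxtrace_mulC !mulmxA VV mul1mx.
    by rewrite -(mulmxA (adj Psi)) U_iso mulmx1.
  rewrite Phi_eq adj_tens adjmx1 tensmx_mul mulmx1 mxtrace_tens mxtrace1 => h.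
  rewrite adjmxZ -scalemxAl -scalemxAr !mxtraceZ mulrA.
  by rewrite fmorphV -invfM mulrC -[c^* * c]mulrC cc invrK mulrC.
- rewrite -/Phi Phi_eq; apply/matrixP=> i j; rewrite !mxE mulrCA; congr (_ * _).
  by rewrite mulVKf.
Qed.

(* With [Q] and [1 - Q] the spectral projections of [H] for the signs, the
   expectation of [G' *m H] over effects [G'] is maximal only at [Q]. *)
Lemma rigidity_sgn (G : 'M[C]_p) (H Q : 'M[C]_n) (h : 'M[C]_q) k l
    (U : 'M[C]_(n * k, p)) (V : 'M[C]_(n * l, q)) (Aux : 'M[C]_(k, l)) (c : C) :
  psd G -> psd (1%:M - G) -> c * c^* = n%:R^-1 ->
  H \in unitmx -> psd (Q *m H) -> psd (Q *m H - H) -> Q *m H = H *m Q ->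
  isometry U -> isometry V -> \tr (adj Aux *m Aux) = 1 ->
  U *m Psi *m V^T = c *: (1%:M *t Aux) ->
  Psi *m h *m V^T = Psi *m V^T *m (H *t 1%:M) ->
  \tr (adj Psi *m (G *m Psi *m h)) = n%:R^-1 * \tr (Q *m H) ->
  U *m (G *m Psi) *m V^T = (Q *t 1%:M) *m (U *m Psi *m V^T).
Proof.
move=> G_psd G1_psd cc H_unit Hp_psd Hm_psd QH U_iso V_iso Aux1 UPsiV hV trG.
set Phi := U *m Psi *m V^T in UPsiV *.
pose G' := U *m G *m adj U.
have G'_psd : psd G' by rewrite /G' -{1}(adjmxK U); apply: psd_conj.
have G'1_psd : psd (1%:M - G').
  (* [U] need not be onto: the projection off its range is added to the image of [1 - G]. *)
  have -> : 1%:M - G' = adj (1%:M - U *m adj U) *m (1%:M - U *m adj U) +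
                       adj (adj U) *m (1%:M - G) *m adj U.
    rewrite adjmxB adjmx1 adjmxM adjmxK projection_compl.
      by rewrite mulmxBr mulmx1 mulmxBl addrA subrK.
    by rewrite mulmxA -(mulmxA U) U_iso mulmx1.
  by apply: psd_add; [apply: psd_adjM|apply: psd_conj].
have G'Phi : G' *m Phi = U *m (G *m Psi) *m V^T.
  by rewrite /G' /Phi !mulmxA -(mulmxA _ (adj U)) U_iso mulmx1 -(mulmxA U).
have VV : V^T *m adj V^T = 1%:M by rewrite adj_trmx -trmx_mul V_iso trmx1.
have PhiX (X : 'M[C]_n) : Phi *m (X *t 1%:M) = (X *t 1%:M) *m Phi.
  by rewrite UPsiV -scalemxAl -scalemxAr !tensmx_mul !mul1mx !mulmx1.
have trPhi (X : 'M[C]_n) : \tr (adj Phi *m Phi *m (X *t 1%:M)) = n%:R^-1 * \tr X.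
  rewrite UPsiV adjmxZ adj_tens adjmx1 -scalemxAl -scalemxAr scalerA.
  rewrite tensmx_mul mul1mx -scalemxAl tensmx_mul mulmx1 mul1mx mxtraceZ mxtrace_tens Aux1.
  by rewrite mulr1 [c^* * c]mulrC cc.
have trG' : \tr (adj Phi *m G' *m Phi *m (H *t 1%:M)) = n%:R^-1 * \tr (Q *m H).
  rewrite -mulmxA -(mulmxA (adj Phi)) (mulmxA G') G'Phi -trG.
  rewrite -!mulmxA (mulmxA Psi (V^T)) -hV /Phi !adjmxM !mulmxA.
  rewrite -(mulmxA _ (adj U)) U_iso mulmx1.
  by rewrite -!mulmxA mxtrace_mulC -!mulmxA VV mulmx1.
(* Two nonnegative traces, one pairing [1 - G'] with the positive part of [H] and one pairing [G']
   with the negative part. Their sum is zero by [trPhi] and [trG'], so each vanishes. *)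
have [pos1 zero1] := mxtrace_psd_sandwich Phi G'1_psd (psd_tens1 l Hp_psd).
have [pos2 zero2] := mxtrace_psd_sandwich Phi G'_psd (psd_tens1 l Hm_psd).
have sum0 : \tr (adj Phi *m (1%:M - G') *m Phi *m ((Q *m H) *t 1%:M)) +
    \tr (adj Phi *m G' *m Phi *m ((Q *m H - H) *t 1%:M)) = 0.
  rewrite tensmxBl !(mulmxBr, mulmxBl) mulmx1 !raddfB /= trPhi trG'.
  by rewrite addrA subrK subrr.
move: (sum0) => /eqP; rewrite paddr_eq0 // => /andP [/eqP /zero1 e1 /eqP /zero2 e2].
have G'H : G' *m Phi *m (H *t 1%:M) = (Q *t 1%:M) *m Phi *m (H *t 1%:M).
  rewrite tensmxBl mulmxBr in e2; rewrite !mulmxBl mul1mx in e1.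
  move/eqP: e2; rewrite subr_eq0 => /eqP <-.
  move/eqP: e1; rewrite subr_eq0 => /eqP <-.
  by rewrite PhiX -mulmxA PhiX mulmxA tensmx_mul mulmx1.
(* Invertibility of [H] allows it to be cancelled on the right. *)
have := congr1 (fun X => X *m (invmx H *t 1%:M)) G'H.
rewrite -!(mulmxA _ (H *t _)) tensmx_mul mulmxV // mulmx1 tensmx11 !mulmx1.
by rewrite G'Phi.
Qed.

End Rigidity.

(** * Strategies in matrix form, and the self-testing theorem *)

Section Strategies.
Variable R : realType.
Local Notation C := R[i].

Lemma POVM_bin_meas d (M : 'I_2 -> 'M[C]_d) : POVM M ->
  [/\ forall b, M b = bin_meas (M ord0) b, psd (M ord0) & psd (1%:M - M ord0)].
Proof.
move=> [M_psd M_sum].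
have M1 : M ord_max = 1%:M - M ord0.
  rewrite -M_sum big_ord_recl big_ord1 addrC addKr; congr M; exact: val_inj.
split=> //; last by rewrite -M1.
move=> b; rewrite /bin_meas; case: eqP => [->//|b0].
rewrite -M1; congr M; apply/val_inj.
by case: b b0 => -[|[|]] //= lt b0; case: b0; apply/val_inj.
Qed.

Lemma bin_meas_sum d (A : 'M[C]_d) : \sum_b bin_meas A b = 1%:M.
Proof. by rewrite big_ord_recl big_ord1 /bin_meas /= addrC subrK. Qed.

Section Correlation.
Variables (NA NB K : nat) (S : strategy R NA NB K).
Let Psi := unvec (state S).

Lemma correlationE a b i j : correlation S a b i j =
  \tr (adj Psi *m (measA S i a *m Psi *m (measB S j b)^T)).
Proof. by rewrite /correlation -mulmxA unvec_dot unvec_tensmul. Qed.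

Lemma correlation_sumB a i j : \sum_b measB S j b = 1%:M ->
  \sum_b correlation S a b i j = \tr (adj Psi *m (measA S i a *m Psi)).
Proof.
move=> sumB; under eq_bigr => b _ do rewrite correlationE.
by rewrite -!raddf_sum /= sumB trmx1 mulmx1.
Qed.

Lemma correlation_sumA b i j : \sum_a measA S i a = 1%:M ->
  \sum_a correlation S a b i j = \tr (adj Psi *m (Psi *m (measB S j b)^T)).
Proof.
move=> sumA; under eq_bigr => a _ do rewrite correlationE.
by rewrite -raddf_sum /= -mulmx_sumr -!mulmx_suml sumA mul1mx.
Qed.

End Correlation.

(** An eigenvalue of [X] exists over the complex numbers; its eigenspace is nonzero and invariant
    under every [P i], hence everything. Symmetry of [P i] reconciles row eigenspaces with the
    transposes in the hypothesis. *)
Lemma schur_of_irreducible n (P : 'I_4 -> 'M[R]_n) :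
  (0 < n)%N -> (forall i, (P i)^T = P i) ->
  (forall V : 'M[C]_n, (forall i, stablemx V (realC (P i))^T) ->
     (V == (0 : 'M[C]_n))%MS || (V == (1%:M : 'M[C]_n))%MS) ->
  forall X : 'M[C]_n, (forall i, X *m realC (P i) = realC (P i) *m X) ->
  exists c : C, X = c%:M.
Proof.
move=> n_gt0 P_sym irr X XP.
have [c Xc] := eigenvalue_closed X n_gt0; exists c.
have /orP [/andP [V0 _]|/andP [_ V1]] : (eigenspace X c == (0 : 'M[C]_n))%MS ||
    (eigenspace X c == (1%:M : 'M[C]_n))%MS.
- apply: irr => i; rewrite /realC map_trmx P_sym.
  by apply: comm_mx_stable_eigenspace; apply: XP.
- by move: Xc; rewrite /eigenvalue -submx0 V0.
by move/sub_kermxP: V1; rewrite mul1mx => /eqP; rewrite subr_eq0 => /eqP.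
Qed.

End Strategies.

Theorem theorem5p10 (R : realType) (n r : nat) (P : 'I_4 -> 'M[R]_n) :
  (* (0) each frak P_i is a real orthogonal projection *)
  (forall i, (P i)^T = P i /\ P i *m P i = P i) ->
  (* (i) P_1 + ... + P_4 = (2 - 1/n) I_n *)
  \sum_(i < 4) P i = (2 - (n%:R)^-1) *: 1%:M ->
  (* (ii) ranks *)
  ((\rank (P ord0))%:Z = (n./2)%:Z - (-1) ^+ n) ->
  (forall i : 'I_4, i != ord0 -> \rank (P i) = n./2) ->
  (* (iii) only 0 and C^n are invariant subspaces of C^n under all P_i
     (subspaces of column vectors v represented as row spaces of v^T) *)
  (forall V : 'M[R[i]]_n,
     (forall i, stablemx V (realC (P i))^T) -> (V == (0 : 'M[R[i]]_n))%MS || (V == (1%:M : 'M[R[i]]_n))%MS) ->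
  (r < n)%N ->
  self_tested (S_nr n r P).
Proof.
move=> P_proj P_sumR rk0 rk irr rn.
have n_gt0 : (0 < n)%N by apply: leq_ltn_trans rn.
pose Pc i : 'M[R[i]]_n := realC (P i).
have P_sym i : (Pc i)^T = Pc i by rewrite /Pc /realC map_trmx; case: (P_proj i) => ->.
have P_herm i : hermitian (Pc i).
  by rewrite /hermitian adj_realC; case: (P_proj i) => ->.
have P_idem i : Pc i *m Pc i = Pc i.
  by rewrite /Pc /realC -map_mxM; case: (P_proj i) => _ ->.
have P_sum : \sum_i Pc i = (2 - n%:R^-1) *: 1%:M.
  by rewrite -map_mx_sum P_sumR map_mxZ map_mx1 rmorphB fmorphV /= !rmorph_nat.
(* Both rank conditions in one formula, with [f = n./2] and [e = (-1) ^+ n]. *)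
have P_tr i : \tr (Pc i) = (n./2)%:R - (-1) ^+ n * (i == ord0)%:R.
  have -> : \tr (Pc i) = (\rank (P i))%:R.
    rewrite -(rmorph_nat (real_complex R)) -mxtrace_idem; last by case: (P_proj i).
    by rewrite /Pc /realC trace_map_mx.
  have [->|i0] := eqVneq i ord0; last by rewrite rk // mulr0 subr0.
  have /(congr1 (fun z : int => z%:~R : R[i])) := rk0.
  by rewrite rmorphB rmorphXn rmorphN1 /= !pmulrn mulr1 => ->.
have e_sqr : ((-1) ^+ n) ^+ 2 = 1 :> R[i] by rewrite sqrr_sign.
have P_schur := schur_of_irreducible n_gt0 (fun i => proj1 (P_proj i)) irr.
pose H : 'M[R[i]]_n := (2 * r%:R - 2^-1) *: 1%:M - n%:R *: (Pc (inord 2) + Pc (inord 3)).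
have H_def : realC ((2 * r%:R - 2^-1 : R) *: 1%:M
    - (n%:R : R) *: (P (inord 2) + P (inord 3))) = H.
  rewrite /realC map_mxB !map_mxZ map_mx1 map_mxD rmorphB rmorphM fmorphV /=.
  by rewrite !rmorph_nat.
have H_unit : H \in unitmx := sgn_argument_unit P_herm P_idem P_sum n_gt0 r.
have H_herm : hermitian H.
  rewrite /hermitian adjmxB !adjmxZ adjmx1 adjmxD !P_herm conjC_nat.
  by rewrite conj_Creal // realB ?realM ?realn ?realV.
have H_sym : H^T = H.
  by rewrite /H raddfB /= !linearZ /= raddfD /= trmx1 !P_sym.
pose Q := frakQ n r P.
have [Hp_psd Hm_psd QH] : [/\ psd (Q *m H), psd (Q *m H - H) & Q *m H = H *m Q].
  apply: sgn_projection_split (sgn_spec_sgn H_herm H_unit) _.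
  by rewrite /Q /frakQ H_def.
move=> S [S_unit [S_A S_B]] S_corr.
case: S S_unit S_A S_B S_corr => p q psi MA MB /= S_unit S_A S_B S_corr.
set S := Strategy psi MA MB in S_corr.
pose Psi := unvec psi.
(* [c%:M] is the matrix of [phi n], so expectations in the reference strategy are traces divided by
   [n]. *)
pose c := (real_complex R (Num.sqrt n%:R))^-1.
have cc : c * c^* = n%:R^-1.
  rewrite conj_Creal; last by rewrite realV complex_real.
  rewrite -invfM -rmorphM /= -expr2 sqr_sqrtr ?ler0n //.
  by rewrite rmorph_nat.
pose w (i : 'I_4) : 'I_5 := widen_ord (leqnSn 4) i.
pose A i := MA (w i) ord0.
pose G := MA ord_max ord0.
pose B j := MB j ord0.
pose X (i : 'I_5) : 'M[R[i]]_n := if (i < 4)%N then Pc (inord i) else Q.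
have Xw i : X (w i) = Pc i by rewrite /X /= ltn_ord inord_val.
have Xmax : X ord_max = Q by [].
have tA i a : measA (S_nr n r P) i a = bin_meas (X i) a.
  by rewrite /= /X; case: ifP.
have tB j b : measB (S_nr n r P) j b = bin_meas (Pc j) b by [].
have tr_c (Y Z : 'M[R[i]]_n) :
    \tr (adj c%:M *m (Y *m c%:M *m Z)) = n%:R^-1 * \tr (Y *m Z).
  rewrite -[c%:M]scalemx1 adjmxZ adjmx1 -scalemxAr mulmx1 -!scalemxAl mul1mx.
  by rewrite scalerA [c^* * c]mulrC cc mxtraceZ.
have corr i j : \tr (adj Psi *m (MA i ord0 *m Psi *m (B j)^T)) = n%:R^-1 * \tr (X i *m Pc j).
  have := S_corr ord0 ord0 i j; rewrite !correlationE tA tB unvec_phi -/c => ->.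
  by rewrite tr_c P_sym.
have corrA i : \tr (adj Psi *m (MA i ord0 *m Psi)) = n%:R^-1 * \tr (X i).
  (* Alice's marginal, obtained by summing over Bob's outcomes for the input [ord0]. *)
  have : \sum_b correlation S ord0 b i ord0 = \sum_b correlation (S_nr n r P) ord0 b i ord0.
    by apply: eq_bigr => b _; apply: S_corr.
  rewrite !correlation_sumB ?bin_meas_sum //; last by case: (S_B ord0).
  by rewrite tA unvec_phi -/c => ->; rewrite -[X in _ *m X]mulmx1 tr_c mulmx1.
have corrB j : \tr (adj Psi *m (Psi *m (B j)^T)) = n%:R^-1 * \tr (Pc j).
  have : \sum_a correlation S a ord0 ord0 j = \sum_a correlation (S_nr n r P) a ord0 ord0 j.
    by apply: eq_bigr => a _; apply: S_corr.
  rewrite !correlation_sumA ?bin_meas_sum //; last by case: (S_A ord0).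
  by rewrite tB unvec_phi -/c => ->; rewrite -[X in _ *m (X *m _)]mul1mx tr_c mul1mx P_sym.
have Psi_unit : \tr (adj Psi *m Psi) = 1 by apply/unvec_unit.
have A_psd i : psd (A i) /\ psd (1%:M - A i) by have [] := POVM_bin_meas (S_A (w i)).
have B_psd j : psd (B j) /\ psd (1%:M - B j) by have [] := POVM_bin_meas (S_B j).
have [k [l [U [V [Aux [[U_iso V_iso Aux1] [Phi_eq UA BV]]]]]]] :=
  rigidity P_herm P_sym P_idem P_sum n_gt0 e_sqr P_tr P_schur Psi_unit A_psd B_psd
    (fun i j => etrans (corr (w i) j) (congr1 (fun Y => n%:R^-1 * \tr (Y *m Pc j)) (Xw i)))
    (fun i => etrans (corrA (w i)) (congr1 (fun Y => n%:R^-1 * \tr Y) (Xw i)))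
    corrB cc.
set Phi := U *m Psi *m V^T in Phi_eq UA.
have UG : U *m (G *m Psi) *m V^T = (Q *t 1%:M) *m Phi.
  have [_ G_psd G1_psd] := POVM_bin_meas (S_A ord_max).
  (* Bob's counterpart of [H]. It is affine in his operators, so its joint expectation with [G] is
     determined by the correlation and Alice's marginal. *)
  pose h := (2 * r%:R - 2^-1) *: 1%:M - n%:R *: ((B (inord 2))^T + (B (inord 3))^T).
  apply: (rigidity_sgn (h := h)) cc H_unit Hp_psd Hm_psd QH U_iso V_iso Aux1 Phi_eq _ _ => //.
    rewrite /H /h tensmxBl !tensmxZl tensmxDl tensmx11 !mulmxBr mulmxBl.
    by rewrite -!scalemxAr -!scalemxAl !mulmxDr mulmxDl !mulmx1 !BV.
  move: (corr ord_max) (corrA ord_max); rewrite Xmax -/G; move: (Q) => Q' corrG corrG1.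
  rewrite /H /h !mulmxBr -!scalemxAr !mulmxDr !mulmx1 !raddfB /= !mxtraceZ !raddfD /=.
  by rewrite !corrG corrG1; ring.
have UM i a : U *m (MA i a *m Psi) *m V^T = (bin_meas (X i) a *t 1%:M) *m Phi.
  have -> : MA i a = bin_meas (MA i ord0) a.
    by have [eM _ _] := POVM_bin_meas (S_A i); apply: eM.
  have U0 : U *m (MA i ord0 *m Psi) *m V^T = (X i *t 1%:M) *m Phi.
    have [i4|i4] := ltnP i 4.
      have -> : i = w (Ordinal i4) by apply: val_inj.
      by rewrite Xw; apply: UA.
    have -> : i = ord_max by apply/val_inj/eqP; rewrite eqn_leq i4 -ltnS ltn_ord.
    by rewrite Xmax; apply: UG.
  rewrite /bin_meas; case: ifP => _ //.
  by rewrite tensmxBl tensmx11 !mulmxBl !mul1mx mulmxBr mulmxBl U0.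
have NV j b : Psi *m (MB j b)^T *m V^T = Psi *m V^T *m ((bin_meas (Pc j) b)^T *t 1%:M).
  have -> : MB j b = bin_meas (MB j ord0) b.
    by have [eM _ _] := POVM_bin_meas (S_B j); apply: eM.
  rewrite /bin_meas; case: ifP => _; first by rewrite P_sym; apply: BV.
  rewrite !raddfB /= !trmx1 tensmxBl tensmx11 !mulmxBr !mulmx1 mulmxBl P_sym.
  by rewrite -[MB j ord0]/(B j) BV.
have [aux auxE] := unvec_surj Aux.
exists k, l, aux, U, V; split=> //; first by apply/unvec_unit; rewrite auxE.
move=> i j a b; apply: unvec_inj.
rewrite unvec_swap_mid !unvec_tensmul auxE tA tB unvec_phi -/c -/Psi.
(* Alice's operator comes out on the left of [Phi] and Bob's on the right; [Phi_eq] then separates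
   the reference factor from [Aux]. *)
have -> : U *m (MA i a *m Psi *m (MB j b)^T) *m V^T =
    (bin_meas (X i) a *t 1%:M) *m Phi *m ((bin_meas (Pc j) b)^T *t 1%:M).
  by rewrite -UM -!mulmxA (mulmxA Psi) NV !mulmxA.
rewrite Phi_eq -scalemxAr -scalemxAl !tensmx_mul !mulmx1 mul1mx.
by rewrite -[c%:M]scalemx1 -scalemxAr mulmx1 -scalemxAl tensmxZl.
Qed.
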